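(* Let $\mathcal{C}_1,\dots,\mathcal{C}_n\in\mathbb{C}^{I_1\times\cdots\times I_N\times I_1\times\cdots\times I_N}$ be positive definite Hermitian tensors with Hermitian rank $r$, and let $\|\cdot\|_{\rho}$ be a unitarily invariant tensor norm with corresponding symmetric gauge function $\rho$. Put $\iota=\sqrt{-1}$ and $\beta_0(t)=\frac{\pi}{2(\cosh(\pi t)+1)}$. (1) For any continuous function $f:(0,\infty)\to[0,\infty)$ such that $x\mapsto \log f(e^x)$ is convex on $\mathbb{R}$, $$\left\| f\left(\exp\left(\sum_{i=1}^n\log\mathcal{C}_i\right)\right)\right\|_{\rho}\le \exp\int_{-\infty}^{\infty}\log\left\| f\left(\left|\prod_{i=1}^n\mathcal{C}_i^{1+\iota t}\right|\right)\right\|_{\rho}\beta_0(t)\,dt.$$ (2) For any continuous function $g:(0,\infty)\to[0,\infty)$ such that $x\mapsto g(e^x)$ is convex on $\mathbb{R}$, $$\left\| g\left(\exp\left(\sum_{i=1}^n\log\mathcal{C}_i\right)\right)\right\|_{\rho}\le \int_{-\infty}^{\infty}\left\| g\left(\left|\prod_{i=1}^n\mathcal{C}_i^{1+\iota t}\right|\right)\right\|_{\rho}\beta_0(t)\,dt.$$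
   Context: Tensors in $\mathbb{T}=\mathbb{C}^{I_1\times\cdots\times I_N\times I_1\times\cdots\times I_N}$ are multiplied by the Einstein product $(\mathcal{A}\star_N\mathcal{B})_{i_1\dots i_N,k_1\dots k_N}=\sum_{j_1,\dots,j_N}a_{i_1\dots i_N j_1\dots j_N}b_{j_1\dots j_N k_1\dots k_N}$; $\prod_{i=1}^n\mathcal{A}_i=\mathcal{A}_1\star_N\cdots\star_N\mathcal{A}_n$ (ordered product). The identity tensor $\mathcal{I}$ has entries $\prod_{k}\delta_{i_k j_k}$. The conjugate transpose $\mathcal{A}^H$ has entries $(\mathcal{A}^H)_{j_1\dots j_N,i_1\dots i_N}=\overline{a_{i_1\dots i_N j_1\dots j_N}}$; $\mathcal{A}$ is Hermitian if $\mathcal{A}^H=\mathcal{A}$, and $\mathcal{U}$ is unitary if $\mathcal{U}^H\star_N\mathcal{U}=\mathcal{U}\star_N\mathcal{U}^H=\mathcal{I}$. Every Hermitian tensor has a decomposition $\mathcal{H}=\sum_{i=1}^r\lambda_i\,\mathcal{U}_i\otimes\mathcal{U}_i^H$ with $\lambda_i\in\mathbb{R}$ and $\mathcal{U}_i\in\mathbb{C}^{I_1\times\cdots\times I_N}$ orthonormal (with respect to $\langle\mathcal{X},\mathcal{Y}\rangle=\mathrm{Tr}(\mathcal{X}^H\mathcal{Y})$); the $\lambda_i$ are the Hermitian eigenvalues and the minimal such $r$ is the Hermitian rank. Positive definite (positive) means all Hermitian eigenvalues are positive. Functions of Hermitian tensors are defined spectrally, $f(\mathcal{H})=\sum_i f(\lambda_i)\mathcal{U}_i\otimes\mathcal{U}_i^H$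 (this defines $\exp$, $\log$ and complex powers $\mathcal{C}^{z}=\exp(z\log\mathcal{C})$ of positive tensors); $|\mathcal{A}|=(\mathcal{A}^H\star_N\mathcal{A})^{1/2}$. A unitarily invariant norm satisfies $\|\mathcal{U}\star_N\mathcal{H}\|_\rho=\|\mathcal{H}\star_N\mathcal{U}\|_\rho=\|\mathcal{H}\|_\rho$ for all unitary $\mathcal{U}$, and is given by $\|\mathcal{H}\|_\rho=\rho(\vec\lambda(|\mathcal{H}|))$ where $\rho:\mathbb{R}^r_{\ge0}\to\mathbb{R}_{\ge0}$ is a symmetric gauge function and $\vec\lambda(\cdot)$ is the vector of Hermitian eigenvalues in decreasing order. *)

(* Defs.v *)
From HB Require Import structures.
From mathcomp Require Import all_boot all_order all_algebra.
From mathcomp Require Import all_classical all_reals all_analysis.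
From mathcomp Require Import perm complex.
Set Implicit Arguments.
Unset Strict Implicit.
Unset Printing Implicit Defensive.
Import Order.TTheory GRing.Theory Num.Theory.
Local Open Scope ring_scope.
Local Open Scope complex_scope.

Section Tensors.
Variable R : realType.
Local Notation C := R[i].
Variables (N : nat) (I : 'I_N -> nat).

Definition midx := {dffun forall k : 'I_N, 'I_(I k)}.
Definition tvec := {ffun midx -> C}.
(* elements of C^{I_1 x ... x I_N x I_1 x ... x I_N}; A i j = a_{i_1..i_N j_1..j_N} *)
Definition tensor := {ffun midx -> {ffun midx -> C}}.

Definition dimT := #|midx|.

Definition tmul (A B : tensor) : tensor :=
  [ffun i => [ffun k => \sum_(j : midx) A i j * B j k]].
Definition tid : tensor :=
  [ffun i : {dffun forall k : 'I_N, 'I_(I k)} =>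
     [ffun j : {dffun forall k : 'I_N, 'I_(I k)} => \prod_(k < N) ((i k == j k)%:R : C)]].
Definition tprod n (A : 'I_n -> tensor) : tensor := \big[tmul/tid]_(i < n) A i.
Definition tH (A : tensor) : tensor := [ffun j => [ffun i => (A i j)^*]].
Definition hermitian (A : tensor) := tH A = A.
Definition unitary (U : tensor) := tmul (tH U) U = tid /\ tmul U (tH U) = tid.

Definition tinner (X Y : tvec) : C := \sum_(i : midx) (X i)^* * Y i.
Definition touter (U : tvec) : tensor := [ffun i => [ffun j => U i * (U j)^*]].

Definition spec_dec (H : tensor) (lam : 'I_dimT -> R) (U : 'I_dimT -> tvec) :=
  (forall a b, tinner (U a) (U b) = (a == b)%:R) /\
  H = \sum_(a < dimT) (lam a)%:C *: touter (U a).

Definition posdef (H : tensor) :=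
  exists lam U, spec_dec H lam U /\ forall a, 0 < lam a.

Definition tfun (f : R -> C) (H : tensor) : tensor :=
  xget 0 (fun X => exists lam U, spec_dec H lam U /\
                    X = \sum_(a < dimT) f (lam a) *: touter (U a)).

Definition texp (H : tensor) := tfun (fun x => (expR x)%:C) H.
Definition tlog (H : tensor) := tfun (fun x => (ln x)%:C) H.
Definition cexp (z : C) : C :=
  (expR (complex.Re z))%:C * ((cos (complex.Im z))%:C + 'i * (sin (complex.Im z))%:C).
Definition tpow (A : tensor) (z : C) := tfun (fun x => cexp (z * (ln x)%:C)) A.
Definition tabs (A : tensor) := tfun (fun x => (Num.sqrt x)%:C) (tmul (tH A) A).

Definition eigvec (H : tensor) : 'rV[R]_dimT :=
  xget (0 : 'rV[R]_dimT) (fun v : 'rV[R]_dimT => (forall a b : 'I_dimT, (a <= b)%N -> v 0 b <= v 0 a) /\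
                   exists U, spec_dec H (fun a => v 0 a) U).

Definition tnorm (rho : 'rV[R]_dimT -> R) (H : tensor) := rho (eigvec (tabs H)).

End Tensors.

Definition sym_gauge (R : realType) (r : nat) (rho : 'rV[R]_r -> R) :=
  [/\ forall x, x != 0 -> 0 < rho x,
      forall (a : R) x, rho (a *: x) = `|a| * rho x,
      forall x y, rho (x + y) <= rho x + rho y,
      forall (s : {perm 'I_r}) (x : 'rV[R]_r), rho (\row_i x 0 (s i)) = rho x &
      forall x : 'rV[R]_r, rho (\row_i `|x 0 i|) = rho x].

Definition cosh (R : realType) (x : R) := (expR x + expR (- x)) / 2.
Definition beta0 (R : realType) (t : R) := pi / (2 * (cosh (pi * t) + 1)).

(* Main.v *)
(* Fix [k] eigenvectors of [L = sum_i log C_i] and let [Y] be the isometry they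
   span.  With [F(z) = prod_i C_i^z], the minor [phi(z) = det (Y^H F(z) Y)] is a
   finite exponential sum with real frequencies; [|phi| <= 1] on the imaginary
   axis because [F] is unitary there, [phi(0) = 1], and [phi'(0)] is the sum of
   the chosen eigenvalues of [L].  On [Re z = 1], [|phi|] is at most the product
   of the [k] largest singular values of [F(1 + it)].  Green's identity for the
   subharmonic function [log |phi|] on the strip [0 <= Re z <= 1], against the
   harmonic kernel with a pole at [0] whose normal derivative on [Re z = 1] is
   [beta0], bounds [phi'(0)] by the [beta0]-average of [log |phi(1 + it)|].  So
   the eigenvalues of [L] are majorized by the average of the logarithms of the
   singular values of [F(1 + it)].  Both inequalities follow by integrating a
   subgradient, at the eigenvalues of [L], of the symmetric convex function
   [x |-> rho (g (e^x))] or [x |-> log (rho (f (e^x)))]. *)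
Require Import Defs.
From HB Require Import structures.
From mathcomp Require Import all_boot all_order all_algebra.
From mathcomp Require Import all_classical all_reals all_analysis.
From mathcomp Require Import measurable_realfun perm complex.
From mathcomp Require Import ring lra.
Import Order.TTheory GRing.Theory Num.Theory.
Import numFieldNormedType.Exports.
Set Implicit Arguments.
Unset Strict Implicit.
Unset Printing Implicit Defensive.
Local Open Scope ring_scope.
Local Open Scope classical_set_scope.


(** * Derivatives of real functions *)

(** Two singularities stand in the way of Green's identity. At a zero of [phi] the function
    [log |phi|] is infinite, so [logmod] uses [log (|phi|^2 + e) / 2], which is smooth and still
    subharmonic. The kernel has its pole at the very boundary point where the derivative is read
    off, so the kernel is translated by [d] and its pole sits at [x = - d]. With the truncation to
    [|t| <= T] this leaves three parameters, controlled by explicit error bounds: first [T] grows,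
    then [d] shrinks, and [e] is fixed small only when the eigenvalue sums are compared.
    Determinants of compressions do the work of antisymmetric tensor powers. Majorization also needs
    equality of the full sums; it holds for every single [t], because [|det F(1 + it)|] does not
    depend on [t]. The singular values are chosen separately for each [t], with no measurability in
    [t]. Hence each partial sum is replaced by a bounded continuous minorant, and only the minorants
    are integrated. *)

Definition has_der (R : realType) (f : R -> R) (x a : R) := is_derive x 1 f a.

Section DeriveKit.
Variable R : realType.
Implicit Types (f g : R -> R) (x a b : R).

Lemma derC (c x : R) : has_der (fun=> c) x 0.
Proof. exact: is_derive_cst. Qed.

Lemma derI x : has_der (fun y => y) x 1.
Proof. exact: is_derive_id. Qed.

(** Lets the rules below build a derivative by [eapply], its value being a unification variable;
    what remains is one algebraic identity for [ring] or [field]. *)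
Lemma der_eq f x a b : has_der f x a -> a = b -> has_der f x b.
Proof. by move=> ? <-. Qed.

Lemma derD f g x a b : has_der f x a -> has_der g x b ->
  has_der (fun y => f y + g y) x (a + b).
Proof. by move=> *; exact: is_deriveD. Qed.

Lemma derN f x a : has_der f x a -> has_der (fun y => - f y) x (- a).
Proof. by move=> *; exact: is_deriveN. Qed.

Lemma derM f g x a b : has_der f x a -> has_der g x b ->
  has_der (fun y => f y * g y) x (a * g x + f x * b).
Proof.
move=> fa gb; have [h1 h2] := is_deriveM fa gb; split; first exact: h1.
by rewrite [LHS]h2 /GRing.scale /= addrC mulrC.
Qed.

Lemma derV f x a : f x != 0 -> has_der f x a ->
  has_der (fun y => (f y)^-1) x (- a / f x ^+ 2).
Proof.
move=> f0 fa; have [h1 h2] := is_deriveV f0 fa; split; first exact: h1.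
by rewrite [LHS]h2 /GRing.scale /= mulNr mulrC mulNr.
Qed.

Lemma derComp f g x a b : has_der f (g x) a -> has_der g x b ->
  has_der (fun y => f (g y)) x (a * b).
Proof.
move=> fa gb; have [h1 h2] := @is_derive1_comp _ f g x a b fa gb.
by split; [exact: h1|rewrite [LHS]h2].
Qed.

Lemma der_cont f x a : has_der f x a -> {for x, continuous f}.
Proof. by move=> [? _]; apply/differentiable_continuous/derivable1_diffP. Qed.

End DeriveKit.

(** * The harmonic kernel of the strip and its derivatives *)

Section Kernel.
Variable R : realType.
Implicit Types (y t : R).

Definition ch t : R := cosh (pi * t).
Definition sh t : R := (expR (pi * t) - expR (- (pi * t))) / 2.

Lemma ch2 t : ch t ^+ 2 = 1 + sh t ^+ 2.
Proof.
rewrite /ch /sh /cosh.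
have : expR (pi * t) * expR (- (pi * t)) = 1 :> R by rewrite -expRD subrr expR0.
set a := expR _; set b := expR _ => ab.
by field: ab.
Qed.

Lemma ch_ge1 t : 1 <= ch t.
Proof.
have a0 := expR_gt0 (pi * t); have b0 := expR_gt0 (- (pi * t)).
rewrite /ch /cosh.
have : expR (pi * t) * expR (- (pi * t)) = 1 :> R by rewrite -expRD subrr expR0.
move: a0 b0; set a := expR _; set b := expR _ => a0 b0 ab.
rewrite ler_pdivlMr //.
have := sqr_ge0 (a - b); nra.
Qed.

Lemma chN t : ch (- t) = ch t.
Proof. by rewrite /ch /cosh mulrN opprK addrC. Qed.

Lemma shN t : sh (- t) = - sh t.
Proof. by rewrite /sh mulrN opprK; field. Qed.

Lemma der_ch t : has_der ch t (pi * sh t).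
Proof.
rewrite /ch /cosh; eapply der_eq.
  eapply derM; last exact: derC.
  eapply derD.
    eapply derComp; first exact: is_derive_expR.
    by eapply derM; [exact: derC|exact: derI].
  eapply derComp; first exact: is_derive_expR.
  by eapply derN; eapply derM; [exact: derC|exact: derI].
by rewrite /sh; field.
Qed.

Lemma der_sh t : has_der sh t (pi * ch t).
Proof.
rewrite /sh; eapply der_eq.
  eapply derM; last exact: derC.
  eapply derD.
    eapply derComp; first exact: is_derive_expR.
    by eapply derM; [exact: derC|exact: derI].
  eapply derN; eapply derComp; first exact: is_derive_expR.
  by eapply derN; eapply derM; [exact: derC|exact: derI].
by rewrite /ch /cosh; field.
Qed.

Lemma der_cospi y : has_der (fun y => cos (pi * y)) y (- (pi * sin (pi * y))).
Proof.
eapply der_eq.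
  eapply derComp; first exact: is_derive_cos.
  by eapply derM; [exact: derC|exact: derI].
by ring.
Qed.

Lemma der_sinpi y : has_der (fun y => sin (pi * y)) y (pi * cos (pi * y)).
Proof.
eapply der_eq.
  eapply derComp; first exact: is_derive_sin.
  by eapply derM; [exact: derC|exact: derI].
by ring.
Qed.

(* [kap y t] is [-1/2] times the imaginary part of [coth (pi (t + iy) / 2)]: it is
   harmonic with a pole at the origin, and vanishes on the line [y = 1]. *)
Definition den y t : R := ch t - cos (pi * y).
Definition kap y t : R := sin (pi * y) * (2 * den y t)^-1.
Definition kapy y t : R :=
  pi * (cos (pi * y) * ch t - 1) * (2 * (den y t * den y t))^-1.
Definition kapt y t : R :=
  - (pi * sin (pi * y) * sh t) * (2 * (den y t * den y t))^-1.
Definition kapyy y t : R :=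
  - (pi ^+ 2 * sin (pi * y) * (ch t * den y t + 2 * (cos (pi * y) * ch t - 1)))
    * (2 * (den y t * den y t * den y t))^-1.

Lemma der_deny y t : has_der (den^~ t) y (pi * sin (pi * y)).
Proof.
rewrite /den; eapply der_eq.
  by eapply derD; [exact: derC|eapply derN; exact: der_cospi].
by ring.
Qed.

Lemma der_dent y t : has_der (den y) t (pi * sh t).
Proof.
rewrite /den; eapply der_eq.
  by eapply derD; [exact: der_ch|exact: derC].
by ring.
Qed.

Lemma der_kapy y t : den y t != 0 -> has_der (kap^~ t) y (kapy y t).
Proof.
move=> d0; rewrite /kap; eapply der_eq.
  eapply derM; first exact: der_sinpi.
  eapply derV; first by rewrite mulf_neq0.
  by eapply derM; [exact: derC|exact: der_deny].
rewrite /kapy.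
have := sin2cos2 (pi * y); move: d0; rewrite /den.
set c := cos _; set s := sin _; set h := ch _ => d0 cs.
by field: cs; rewrite d0.
Qed.

Lemma der_kapt y t : den y t != 0 -> has_der (kap y) t (kapt y t).
Proof.
move=> d0; rewrite /kap; eapply der_eq.
  eapply derM; first exact: derC.
  eapply derV; first by rewrite mulf_neq0.
  by eapply derM; [exact: derC|exact: der_dent].
by rewrite /kapt; field; rewrite d0.
Qed.

Lemma der_kapyy y t : den y t != 0 -> has_der (kapy^~ t) y (kapyy y t).
Proof.
move=> d0; rewrite /kapy; eapply der_eq.
  eapply derM.
    eapply derM; first exact: derC.
    eapply derD; last exact: derC.
    by eapply derM; [exact: der_cospi|exact: derC].
  eapply derV; first by rewrite !mulf_neq0.
  by eapply derM; [exact: derC|eapply derM; exact: der_deny].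
by rewrite /kapyy; field; rewrite d0.
Qed.

(** Together with [der_kapyy] this is the harmonicity of [kap]. *)
Lemma der_kaptt y t : den y t != 0 -> has_der (kapt y) t (- kapyy y t).
Proof.
move=> d0; rewrite /kapt; eapply der_eq.
  eapply derM.
    eapply derN; eapply derM; first exact: derC.
    exact: der_sh.
  eapply derV; first by rewrite !mulf_neq0.
  by eapply derM; [exact: derC|eapply derM; exact: der_dent].
have hk : sh t ^+ 2 = ch t ^+ 2 - 1 by rewrite ch2; ring.
have := sin2cos2 (pi * y); move: d0 hk; rewrite /kapyy /den.
set c := cos _; set s := sin _; set h := ch _; set k := sh _ => d0 hk cs.
by field: hk cs; rewrite d0.
Qed.

End Kernel.

(** * Integrals over segments, and bounds for the kernel *)

Section Integrals.
Variable R : realType.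
Notation mu := (@lebesgue_measure R).
Implicit Types (f F : R -> R) (a b : R).

Lemma integrable_itv f a b : continuous f ->
  mu.-integrable `[a, b] (EFin \o f).
Proof.
move=> cf; apply: continuous_compact_integrable; first exact: segment_compact.
exact: continuous_subspaceT.
Qed.

Lemma Rintegral_FTC F f a b : a < b -> (forall t, has_der F t (f t)) ->
  continuous f -> \int[mu]_(t in `[a, b]) f t = F b - F a.
Proof.
move=> ab dF cf.
rewrite /Rintegral (@continuous_FTC2 _ f F a b) //.
- exact: continuous_subspaceT.
- split.
  + by move=> x _; case: (dF x).
  + by apply: cvg_at_right_filter; exact: (der_cont (dF a)).
  + by apply: cvg_at_left_filter; exact: (der_cont (dF b)).
- by move=> x _; rewrite derive1E; case: (dF x).
Qed.

End Integrals.

Section Trig.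
Variable R : realType.
Implicit Types (d y t : R).

Lemma cospi_lt1 d : 0 < d < 1 -> cos (pi * d) < 1 :> R.
Proof.
move=> /andP[d0 d1]; have p0 := pi_gt0 R.
rewrite -[ltRHS]cos0 ltr_cos ?in_itv /=; nra.
Qed.

(** Cosine is symmetric about [pi], which reduces the claim to [y <= 1]. The range passes [1]
    because derivatives are later taken on an open interval around the line [y = 1]. *)
Lemma cospi_le d y : 0 < d < 1 -> d <= y <= 2 - d ->
  cos (pi * y) <= cos (pi * d).
Proof.
move=> /andP[d0 d1] /andP[dy yd]; have p0 := pi_gt0 R.
have mono (z : R) : d <= z <= 1 -> cos (pi * z) <= cos (pi * d).
  move=> /andP[dz z1].
  have [-> //|dz'] := eqVneq z d.
  have {}dz : d < z by rewrite lt_neqAle eq_sym dz'.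
  by apply/ltW; rewrite ltr_cos ?in_itv /=; nra.
have [y1|y1] := leP y 1; first by apply: mono; rewrite dy.
have -> : cos (pi * y) = cos (pi * (2 - y)).
  rewrite -[RHS]cosN -(cosD2pi (- _)); congr cos.
  by rewrite -mulr_natr; ring.
apply: mono; lra.
Qed.

Lemma den_ge d y t : 0 < d < 1 -> d <= y <= 2 - d ->
  1 - cos (pi * d) <= den y t.
Proof. by move=> d01 dy; rewrite /den lerB ?ch_ge1 ?cospi_le. Qed.

Lemma den_gt0 d y t : 0 < d < 1 -> d <= y <= 2 - d -> 0 < den y t.
Proof.
move=> d01 dy; apply: lt_le_trans (den_ge t d01 dy).
by rewrite subr_gt0 cospi_lt1.
Qed.

End Trig.

Section ContinuousKernel.
Variables (R : realType) (y : R).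

Lemma cch : continuous (@ch R).
Proof. by move=> t; exact: der_cont (der_ch t). Qed.

Lemma continuous_den : continuous (den y).
Proof. by move=> t; exact: der_cont (der_dent y t). Qed.

Hypothesis den0 : forall t, den y t != 0.

Lemma continuous_kap : continuous (kap y).
Proof. by move=> t; exact: der_cont (der_kapt (den0 t)). Qed.

Lemma continuous_kapy : continuous (kapy y).
Proof.
move=> t; rewrite /kapy; apply: cvgM.
  apply: cvgM; first exact: cvg_cst.
  apply: cvgB; last exact: cvg_cst.
  by apply: cvgM; [exact: cvg_cst|exact: cch].
apply: cvgV; first by rewrite !mulf_neq0 ?den0.
by apply: cvgM; [exact: cvg_cst|apply: cvgM; exact: continuous_den].
Qed.

Lemma continuous_kapyy : continuous (kapyy y).
Proof.
move=> t; rewrite /kapyy; apply: cvgM.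
  apply: cvgN; apply: cvgM; first exact: cvg_cst.
  apply: cvgD.
    by apply: cvgM; [exact: cch|exact: continuous_den].
  apply: cvgM; first exact: cvg_cst.
  apply: cvgB; last exact: cvg_cst.
  by apply: cvgM; [exact: cvg_cst|exact: cch].
apply: cvgV; first by rewrite !mulf_neq0 ?den0.
apply: cvgM; first exact: cvg_cst.
by apply: cvgM; [apply: cvgM|]; exact: continuous_den.
Qed.

End ContinuousKernel.

(** * Green's identity on the strip *)

Section Green.
Variable R : realType.
Notation mu := (@lebesgue_measure R).
Implicit Types (x y t : R).
Variables (u ux ut uxx utt : R -> R -> R) (M : R).
Hypothesis u_x : forall x t, has_der (u^~ t) x (ux x t).
Hypothesis u_xx : forall x t, has_der (ux^~ t) x (uxx x t).
Hypothesis u_t : forall x t, has_der (u x) t (ut x t).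
Hypothesis u_tt : forall x t, has_der (ut x) t (utt x t).
Hypothesis cux : forall x, continuous (ux x).
Hypothesis cuxx : forall x, continuous (uxx x).
Hypothesis cutt : forall x, continuous (utt x).
Hypothesis lap : forall x t, 0 <= uxx x t + utt x t.
Hypothesis bu : forall (x t : R), -1 <= x <= 2 -> `|u x t| <= M.
Hypothesis but : forall (x t : R), -1 <= x <= 2 -> `|ut x t| <= M.
Hypothesis buxx : forall (x t : R), -1 <= x <= 2 -> `|uxx x t| <= M.

Let cu x : continuous (u x).
Proof. by move=> t; exact: der_cont (u_t x t). Qed.

Variables (d T : R).
Hypothesis d01 : 0 < d < 1.
Hypothesis T0 : 0 < T.

(** The kernel is evaluated at [y = x + d]. The margin [d / 2] leaves an open interval of [x] around
    [[0, 1 - d]] and keeps [y] away from the poles at [0] and [2]. *)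
Let good y := d / 2 <= y <= 2 - d / 2.

Let d201 : 0 < d / 2 < 1. Proof. by have := d01; lra. Qed.

Let den0 y t : good y -> den y t != 0.
Proof. by move=> gy; rewrite gt_eqF // (den_gt0 t d201). Qed.

Let ckap y : good y -> continuous (kap y).
Proof. by move=> gy; apply: continuous_kap => t; exact: den0. Qed.

Let ckapy y : good y -> continuous (kapy y).
Proof. by move=> gy; apply: continuous_kapy => t; exact: den0. Qed.

Let ckapyy y : good y -> continuous (kapyy y).
Proof. by move=> gy; apply: continuous_kapyy => t; exact: den0. Qed.

Let b := 1 - cos (pi * (d / 2)) : R.

Let b0 : 0 < b.
Proof. by rewrite subr_gt0 cospi_lt1. Qed.

Lemma kap_bound (y t : R) : good y -> `|kap y t| <= (2 * b)^-1.
Proof.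
move=> gy; rewrite /kap normrM normfV.
have dg := den_ge t d201 gy.
rewrite -[leRHS]mul1r ler_pM ?invr_ge0 ?normr_ge0 ?sin_max //.
rewrite lef_pV2 ?posrE ?mulr_gt0 ?normr_gt0 ?mulf_neq0 ?den0 //.
rewrite normrM ger0_norm // ler_pM2l //; apply: le_trans dg _.
by rewrite ler_norm.
Qed.

Lemma kapyy_bound (y t : R) : good y ->
  `|kapyy y t| <= pi ^+ 2 * (ch t * (ch t + 1) + 2 * (ch t + 1))
                   * (2 * (b * b * b))^-1.
Proof.
move=> gy; rewrite /kapyy normrM normfV normrN.
have dg := den_ge t d201 gy.
have c1 := ch_ge1 t.
have dp := den_gt0 t d201 gy.
have cm := cos_max (pi * y).
apply: ler_pM; rewrite ?invr_ge0 ?normr_ge0 //.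
- rewrite -mulrA normrM (normrM (sin _)) ger0_norm ?sqr_ge0 // ler_wpM2l ?sqr_ge0 //.
  rewrite -[leRHS]mul1r ler_pM ?normr_ge0 ?sin_max //.
  have nc : `|ch t| = ch t by rewrite ger0_norm //; lra.
  apply: le_trans (ler_normD _ _) _.
  rewrite (normrM (ch t)) (normrM 2) nc (ger0_norm (_ : 0 <= 2)) //.
  apply: lerD.
    rewrite ler_wpM2l; [by []|lra|].
    by rewrite /den (le_trans (ler_normB _ _)) // nc lerD2l.
  rewrite ler_wpM2l //.
  rewrite (le_trans (ler_normB _ _)) // normr1 lerD2r (normrM (cos _)) nc.
  by rewrite -[leRHS]mul1r ler_wpM2r //; lra.
- rewrite ger0_norm; last by rewrite !mulr_ge0 // ltW.
  rewrite lef_pV2 ?posrE ?mulr_gt0 // ler_pM2l //.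
  by rewrite !ler_pM ?mulr_ge0 // ?(ltW b0).
Qed.

(** [Phi x] is the Green flux through the vertical segment at [x], for the kernel with its pole
    moved to [x = - d]. *)
Let F x t := kap (x + d) t * ux x t - kapy (x + d) t * u x t.
Let F' x t := kap (x + d) t * uxx x t - kapyy (x + d) t * u x t.
Let Phi x := \int[mu]_(t in `[- T, T]) F x t.

Let goodx x : - (d / 2) < x < 1 - d / 2 -> good (x + d).
Proof. by rewrite /good; have := d01; lra. Qed.

Let stripx x : - (d / 2) < x < 1 - d / 2 -> -1 <= x <= 2.
Proof. by have := d01; lra. Qed.

Let dF x t : - (d / 2) < x < 1 - d / 2 -> has_der (F^~ t) x (F' x t).
Proof.
move=> xd; have gx := goodx xd.
have shift (k k' : R -> R -> R) : has_der (k^~ t) (x + d) (k' (x + d) t) ->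
    has_der (fun x => k (x + d) t) x (k' (x + d) t).
  move=> dk; eapply der_eq.
    eapply (derComp (f := k^~ t)); first exact: dk.
    by eapply derD; [exact: derI|exact: derC].
  by rewrite addr0 mulr1.
rewrite /F; eapply der_eq.
  eapply derD; [eapply derM|eapply derN, derM].
  - exact: shift (der_kapy (den0 t gx)).
  - exact: u_xx.
  - exact: shift (der_kapyy (den0 t gx)).
  - exact: u_x.
by rewrite /F'; ring.
Qed.

Let cF x : - (d / 2) < x < 1 - d / 2 -> continuous (F x).
Proof.
move=> /goodx gx t.
apply: cvgB; apply: cvgM; [exact: ckap|exact: cux|exact: ckapy|exact: cu].
Qed.

Let cF' x : - (d / 2) < x < 1 - d / 2 -> continuous (F' x).
Proof.
move=> /goodx gx t.
apply: cvgB; apply: cvgM; [exact: ckap|exact: cuxx|exact: ckapyy|exact: cu].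
Qed.

(** Dominating function for differentiating [Phi] under the integral sign. It is uniform in [x]; its
    growth in [t] is harmless on [[- T, T]]. *)
Let G t : R := (2 * b)^-1 * M +
  pi ^+ 2 * (ch t * (ch t + 1) + 2 * (ch t + 1)) * (2 * (b * b * b))^-1 * M.

Let M0 : 0 <= M.
Proof. by have := @bu 0 0; rewrite lerN10 ler0n => /(_ isT); apply: le_trans. Qed.

Let cG : continuous G.
Proof.
move=> t; apply: cvgD; first exact: cvg_cst.
do 2 (apply: cvgM; last exact: cvg_cst).
apply: cvgM; first exact: cvg_cst.
apply: cvgD; apply: cvgM; try exact: cvg_cst; try exact: cch.
- by apply: cvgD; [exact: cch|exact: cvg_cst].
- by apply: cvgD; [exact: cch|exact: cvg_cst].
Qed.

Let G_ge0 t : 0 <= G t.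
Proof.
have c1 := ch_ge1 t.
have h : 0 <= ch t * (ch t + 1) + 2 * (ch t + 1) by nra.
apply: addr_ge0; first by rewrite mulr_ge0 // invr_ge0 mulr_ge0 // ltW.
apply: mulr_ge0 => //; apply: mulr_ge0.
  by apply: mulr_ge0 => //; exact: sqr_ge0.
by rewrite invr_ge0; do 3 (apply: mulr_ge0 => //; try exact: ltW).
Qed.

Let F'G x t : - (d / 2) < x < 1 - d / 2 -> `|F' x t| <= G t.
Proof.
move=> xd; have gx := goodx xd; have sx := stripx xd.
rewrite /F' (le_trans (ler_normB _ _)) // (normrM (kap _ _)) (normrM (kapyy _ _)).
apply: lerD; apply: ler_pM; rewrite ?normr_ge0 //.
- exact: kap_bound.
- exact: buxx.
- exact: kapyy_bound.
- exact: bu.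
Qed.

Let dPhi x : - (d / 2) < x < 1 - d / 2 ->
  has_der Phi x (\int[mu]_(t in `[- T, T]) F' x t).
Proof.
move=> xd.
have Ix : `](- (d / 2)), (1 - d / 2)[%classic x by rewrite /= in_itv.
have d1 z t : - (d / 2) < z < 1 - d / 2 -> partial1of2 F z t = F' z t.
  by move=> zd; rewrite partial1of2E; case: (dF t zd).
have intF z : `](- (d / 2)), (1 - d / 2)[%classic z ->
    mu.-integrable `[- T, T] (EFin \o F z).
  by rewrite /= in_itv /= => zd; apply: integrable_itv; exact: cF.
have derF z t : `](- (d / 2)), (1 - d / 2)[%classic z ->
    `[- T, T]%classic t -> derivable (F^~ t) z 1.
  by rewrite /= in_itv /= => zd _; case: (dF t zd).
have intG := integrable_itv (- T) T cG.
have ubG z t : `](- (d / 2)), (1 - d / 2)[%classic z ->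
    `[- T, T]%classic t -> `|partial1of2 F z t| <= G t.
  by rewrite /= in_itv /= => zd _; rewrite d1 //; exact: F'G.
split.
  exact: (@derivable_under_integral _ _ _ mu F _ (measurable_itv _) _ _ _ Ix intF derF G G_ge0 intG ubG).
rewrite -derive1E (@differentiation_under_integral _ _ _ mu F _ (measurable_itv _) _ _ _ Ix intF derF G G_ge0 intG ubG).
by apply: eq_Rintegral => t _; exact: d1.
Qed.

(** Density of the flux through the horizontal ends of the rectangle. *)
Let bdry x t := kapt (x + d) t * u x t - kap (x + d) t * ut x t.

Let bdry_bound x t : - (d / 2) < x < 1 - d / 2 -> 1 < ch t ->
  `|bdry x t| <=
    M * ((2 * (ch t - 1))^-1 + pi * `|sh t| / (2 * (ch t - 1) ^+ 2)).
Proof.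
move=> xd c1; have gx := goodx xd; have sx := stripx xd.
have dp := den_gt0 t d201 gx.
have dge : ch t - 1 <= den (x + d) t by rewrite /den lerB // cos_le1.
have c0 : 0 < ch t - 1 by lra.
have bk : `|kap (x + d) t| <= (2 * (ch t - 1))^-1.
  rewrite /kap normrM (normfV (2 * _)) (normrM 2) (ger0_norm (_ : 0 <= 2)) //.
  rewrite (gtr0_norm dp) -[leRHS]mul1r ler_pM ?invr_ge0 ?sin_max //.
    by rewrite mulr_ge0 // ltW.
  by rewrite lef_pV2 ?posrE ?mulr_gt0 // ler_pM2l.
have bt : `|kapt (x + d) t| <= pi * `|sh t| / (2 * (ch t - 1) ^+ 2).
  rewrite /kapt normrM normrN (normrM (pi * _)) (normrM pi).
  rewrite (ger0_norm (pi_ge0 R)) (normfV (2 * _)).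
  have dd0 : 0 < 2 * (den (x + d) t * den (x + d) t) by rewrite !mulr_gt0.
  rewrite (gtr0_norm dd0).
  apply: ler_pM; rewrite ?mulr_ge0 ?pi_ge0 //; first by rewrite invr_ge0 ltW.
    rewrite ler_wpM2r // -[leRHS]mulr1 ler_wpM2l ?pi_ge0 //.
    exact: sin_max.
  rewrite lef_pV2 ?posrE ?mulr_gt0 ?exprn_gt0 // ler_pM2l // expr2.
  by apply: ler_pM; rewrite // ltW.
have := bu t sx; have := but t sx => ? ?.
rewrite /bdry (le_trans (ler_normB _ _)) //.
rewrite (normrM (kapt _ _)) (normrM (kap _ _)) addrC mulrDr ![M * _]mulrC.
by apply: lerD; apply: ler_pM; rewrite ?normr_ge0.
Qed.

Let dbdry x t : - (d / 2) < x < 1 - d / 2 ->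
  has_der (bdry x) t (- kapyy (x + d) t * u x t - kap (x + d) t * utt x t).
Proof.
move=> xd; have gx := goodx xd; rewrite /bdry; eapply der_eq.
  eapply derD; [eapply derM|eapply derN, derM].
  - exact: der_kaptt (den0 t gx).
  - exact: u_t.
  - exact: der_kapt (den0 t gx).
  - exact: u_tt.
by ring.
Qed.

Let cdbdry x : - (d / 2) < x < 1 - d / 2 ->
  continuous (fun t => - kapyy (x + d) t * u x t - kap (x + d) t * utt x t).
Proof.
move=> /goodx gx t.
apply: cvgB; apply: cvgM; [|exact: cu|exact: ckap|exact: cutt].
by apply: cvgN; exact: ckapyy.
Qed.

(** The estimate [bdry_bound] at [t = T] and at [t = - T], added up: the two copies absorb the
    factors [1 / 2]. *)
Definition green_err := M * ((ch T - 1)^-1 + pi * `|sh T| / (ch T - 1) ^+ 2).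

Hypothesis chT : 1 < ch T.

(* Integration by parts in [t] turns [- kapyy * u] into [kap * utt], so the
   derivative of [Phi] is the integral of [kap] times the Laplacian of [u],
   up to boundary terms. *)
Let dPhi_ge x : - (d / 2) < x < 1 - d / 2 -> x <= 1 - d -> 
  - green_err <= \int[mu]_(t in `[- T, T]) F' x t.
Proof.
move=> xd x1; have gx := goodx xd.
have TT : - T < T by have := T0; lra.
have := Rintegral_FTC TT (fun t => dbdry t xd) (cdbdry xd).
have b1 := bdry_bound xd chT.
have b2 : `|bdry x (- T)| <= M * ((2 * (ch T - 1))^-1 + pi * `|sh T| / (2 * (ch T - 1) ^+ 2)).
  by have := @bdry_bound x (- T) xd; rewrite chN shN normrN; apply.
set I1 := Rintegral _ _ _ => eI1.
have : I1 <= \int[mu]_(t in `[- T, T]) F' x t.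
  apply: le_Rintegral => //.
  - exact/integrable_itv/cdbdry.
  - exact/integrable_itv/cF'.
  - move=> t _ ; rewrite /F' -subr_ge0.
    have -> : kap (x + d) t * uxx x t - kapyy (x + d) t * u x t -
      (- kapyy (x + d) t * u x t - kap (x + d) t * utt x t) =
      kap (x + d) t * (uxx x t + utt x t) by ring.
    (* Here [x <= 1 - d] matters: it keeps [x + d] in the range where [sin (pi * _)], hence [kap],
       is nonnegative. *)
    rewrite mulr_ge0 // mulr_ge0 //.
      rewrite sin_ge0_pi // mulr_ge0 ?pi_ge0 //=; last first.
        by have := gx; have := d01; rewrite /good; lra.
      rewrite -[leRHS]mulr1 ler_wpM2l ?pi_ge0 //; lra.
    by rewrite invr_ge0 mulr_ge0 // ltW // (den_gt0 t d201 gx).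
apply: le_trans; rewrite eI1 /green_err.
move: b1 b2; rewrite !ler_norml => /andP[b1 _] /andP[_ b2].
have c0 : ch T - 1 != 0 by rewrite gt_eqF // subr_gt0.
have -> : - (M * ((ch T - 1)^-1 + pi * `|sh T| / (ch T - 1) ^+ 2)) =
  - (M * ((2 * (ch T - 1))^-1 + pi * `|sh T| / (2 * (ch T - 1) ^+ 2))) -
  (M * ((2 * (ch T - 1))^-1 + pi * `|sh T| / (2 * (ch T - 1) ^+ 2))).
  by field.
by apply: lerD => //; rewrite lerN2.
Qed.

(** Mean value theorem for [Phi] on [[0, 1 - d]]. At the right end the kernel is taken on [y = 1],
    where [kap] vanishes and [- kapy] equals [beta0]. *)
Lemma green :
  \int[mu]_(t in `[- T, T]) (kap d t * ux 0 t - kapy d t * u 0 t) <=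
  \int[mu]_(t in `[- T, T]) (beta0 t * u (1 - d) t) + green_err.
Proof.
have dom x : 0 <= x <= 1 - d -> - (d / 2) < x < 1 - d / 2.
  by have := d01; lra.
have d1 : 0 < 1 - d by have := d01; lra.
have [||c cI e] := @MVT _ Phi (fun x => \int[mu]_(t in `[- T, T]) F' x t) 0 (1 - d) d1.
- move=> x; rewrite in_itv /= => /andP[x0 x1]; apply: dPhi; apply: dom.
  by rewrite !ltW.
- apply: derivable_within_continuous => x; rewrite in_itv /= => x01.
  by case: (dPhi (dom x x01)).
have e0 : Phi 0 = \int[mu]_(t in `[- T, T]) (kap d t * ux 0 t - kapy d t * u 0 t).
  by apply: eq_Rintegral => t _; rewrite /F add0r.
have e1 : Phi (1 - d) = \int[mu]_(t in `[- T, T]) (beta0 t * u (1 - d) t).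
  apply: eq_Rintegral => t _; rewrite /F subrK /kap /kapy /beta0 mulr1 sinpi cospi.
  rewrite mul0r mul0r sub0r -mulNr; congr (_ * _).
  rewrite /den mulr1 cospi opprK /ch.
  have := ch_ge1 t; rewrite /ch; set h := cosh _ => h1.
  by field; rewrite gt_eqF //; lra.
rewrite -e0 -e1 -lerBlDl -opprB lerNl.
rewrite e.
move: cI; rewrite in_itv /= => /andP[c0 c1].
have c01 : 0 <= c <= 1 - d by rewrite !ltW.
have h := dPhi_ge (dom c c01) (ltW c1).
have err0 : 0 <= green_err.
  apply: mulr_ge0 => //; apply: addr_ge0; first by rewrite invr_ge0 subr_ge0 ltW.
  by rewrite !mulr_ge0 ?pi_ge0 // invr_ge0 sqr_ge0.
by have := d01; nra.
Qed.

End Green.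

(** * The probability density [beta0] *)

Section Beta0.
Variable R : realType.
Notation mu := (@lebesgue_measure R).
Implicit Types (t : R).

Lemma beta0E t : beta0 t = pi / (2 * (ch t + 1)).
Proof. by []. Qed.

Lemma beta0_gt0 t : 0 < beta0 t.
Proof.
rewrite beta0E divr_gt0 ?pi_gt0 // mulr_gt0 //.
by have := ch_ge1 t; lra.
Qed.

Lemma beta0_ge0 t : 0 <= beta0 t.
Proof. exact/ltW/beta0_gt0. Qed.

Lemma continuous_beta0 : continuous (@beta0 R).
Proof.
move=> t; apply: cvgM; first exact: cvg_cst.
apply: cvgV.
  by rewrite mulf_neq0 // gt_eqF //; have := ch_ge1 t; rewrite /ch; lra.
apply: cvgM; first exact: cvg_cst.
by apply: cvgD; [exact: cch|exact: cvg_cst].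
Qed.

(** An antiderivative of [beta0] running from [0] to [1]. It gives the total mass [1] and, through
    [logistic_ge], a tail of order [1 / T]. *)
Definition logistic t : R := (1 + expR (- (pi * t)))^-1.

Lemma der_logistic t : has_der logistic t (beta0 t).
Proof.
have e0 : 0 < expR (- (pi * t)) by exact: expR_gt0.
rewrite /logistic; eapply der_eq.
  eapply derV; first by rewrite gt_eqF //; lra.
  eapply derD; first exact: derC.
  eapply derComp; first exact: is_derive_expR.
  by eapply derN, derM; [exact: derC|exact: derI].
have -> : beta0 t = pi / (2 * (((expR (- (pi * t)))^-1 + expR (- (pi * t))) / 2 + 1)).
  by rewrite beta0E /ch /cosh expRN invrK.
move: e0; set e := expR _ => e0.
by field; rewrite !gt_eqF //; nra.
Qed.

Lemma logisticN t : logistic (- t) = 1 - logistic t.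
Proof.
rewrite /logistic mulrN opprK expRN; have := expR_gt0 (pi * t).
by set e := expR _ => e0; field; rewrite !gt_eqF //; lra.
Qed.

Lemma logistic_ge t : 0 < t -> 1 - t^-1 <= logistic t.
Proof.
move=> t0; have := expR_gt0 (pi * t); have := expR_ge1Dx (pi * t).
have p2 := pi_ge2 R; rewrite /logistic expRN; set e := expR _ => h e0.
have -> : (1 + e^-1)^-1 = 1 - (1 + e)^-1 by field; rewrite !gt_eqF //; lra.
by rewrite lerB // lef_pV2 ?posrE //; nra.
Qed.

Lemma logistic_le1 t : logistic t <= 1.
Proof.
rewrite /logistic invf_le1; have := expR_gt0 (- (pi * t)); lra.
Qed.

Lemma cvg_logistic : logistic t @[t --> +oo] --> (1 : R).
Proof.
apply: (@squeeze_cvgr _ _ _ _ (fun t => 1 - t^-1) (fun=> 1)).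
- near=> t; apply/andP; split; [apply: logistic_ge|exact: logistic_le1].
  by near: t; exact: nbhs_pinfty_gt.
- rewrite -[X in _ --> X]subr0; apply: cvgB; first exact: cvg_cst.
  apply/cvgrPdist_lt => e e0; near=> t.
  have t0 : 0 < t by near: t; exact: nbhs_pinfty_gt.
  rewrite sub0r normrN gtr0_norm ?invr_gt0 // invf_plt ?posrE //.
  by near: t; apply: nbhs_pinfty_gt; rewrite num_real.
- exact: cvg_cst.
Unshelve. all: by end_near.
Qed.

Lemma integral_beta0 : (\int[mu]_(t in setT) (beta0 t)%:E = 1)%E.
Proof.
rewrite ge0_symfun_integralT.
- rewrite -set_itvcy (@ge0_continuous_FTC2y _ _ logistic 0 1).
  + rewrite /logistic mulr0 oppr0 expR0 -EFinB -EFinM; congr EFin; by field.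
  + by move=> t _; exact: beta0_ge0.
  + exact/continuous_subspaceT/continuous_beta0.
  + exact: cvg_logistic.
  + by move=> t _; case: (der_logistic t).
  + by apply: cvg_at_right_filter; exact: (der_cont (der_logistic 0)).
  + by move=> t _; rewrite derive1E; case: (der_logistic t).
- exact: beta0_ge0.
- exact: continuous_beta0.
- by move=> t; rewrite /= !beta0E chN.
Qed.

Lemma integrable_beta0M (b : R -> R) (M : R) : continuous b ->
  (forall t, `|b t| <= M) -> mu.-integrable setT (fun t => (b t * beta0 t)%:E).
Proof.
move=> cb bM; have M0 : 0 <= M := le_trans (normr_ge0 _) (bM 0).
apply: (@le_integrable _ _ _ mu setT _ _ (fun t => (M * beta0 t)%:E)) => //.
- apply/measurable_EFinP; apply: continuous_measurable_fun => t.
  by apply: cvgM; [exact: cb|exact: continuous_beta0].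
- move=> t _; rewrite lee_fin normrM (ger0_norm (beta0_ge0 t)).
  rewrite (ger0_norm (_ : 0 <= M * _)); last by rewrite mulr_ge0 ?beta0_ge0.
  by rewrite ler_wpM2r ?beta0_ge0.
- apply/integrableP; split.
    apply/measurable_EFinP; apply: continuous_measurable_fun => t.
    by apply: cvgM; [exact: cvg_cst|exact: continuous_beta0].
  have -> : (\int[mu]_(t in setT) `|(M * beta0 t)%:E| =
      \int[mu]_(t in setT) (M%:E * (beta0 t)%:E))%E.
    apply: eq_integral => t _; rewrite -EFinM /= ger0_norm //.
    by rewrite mulr_ge0 ?beta0_ge0.
  rewrite ge0_integralZl_EFin //.
  + by rewrite integral_beta0 mule1 ltry.
  + by move=> t _; rewrite lee_fin beta0_ge0.
  + apply/measurable_EFinP; apply: continuous_measurable_fun.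
    exact: continuous_beta0.
Qed.

Lemma Rintegral_beta0M (c : R) : \int[mu]_t (c * beta0 t) = c.
Proof.
have ib : mu.-integrable setT (fun t => (beta0 t)%:E).
  have c1 : continuous (fun _ : R => 1 : R) by move=> ?; exact: cvg_cst.
  have := integrable_beta0M (M := 1) c1.
  rewrite normr1 => /(_ (fun=> lexx 1)); apply: eq_integrable => // t _.
  by rewrite mul1r.
by rewrite (RintegralZl c measurableT ib) /Rintegral integral_beta0 mulr1.
Qed.

End Beta0.

Section Elementary.
Variable R : realType.
Implicit Types (t : R).

Lemma der_lipschitz (f f' : R -> R) (K a b : R) :
  (forall x, has_der f x (f' x)) ->
  (forall x, Num.min a b <= x <= Num.max a b -> `|f' x| <= K) ->
  `|f b - f a| <= K * `|b - a|.
Proof.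
move=> df.
wlog ab : a b / a <= b.
  move=> h hK; have [ab|/ltW ba] := leP a b; first exact: h.
  by rewrite distrC (distrC b); apply: h => // x; rewrite minC maxC; exact: hK.
rewrite (min_idPl ab) (max_idPr ab) => fK.
have [||c] := @MVT_segment _ f f' a b ab.
- by move=> x _; exact: df.
- by apply: continuous_subspaceT => x; exact: der_cont (df x).
rewrite in_itv /= => cab ->.
by rewrite normrM ler_wpM2r // fK.
Qed.

Lemma sinpi_le t : 0 <= t -> sin (pi * t) <= pi * t.
Proof.
move=> t0; apply: le_trans (ler_norm _) _.
have := @der_lipschitz (@sin R) (@cos R) 1 0 (pi * t) (@is_derive_sin R).
rewrite sin0 !subr0 mul1r (ger0_norm (_ : 0 <= pi * t)); last first.
  by rewrite mulr_ge0 ?pi_ge0.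
by apply=> x _; exact: cos_max.
Qed.

(** [ch t - 1] equals [2 * sinh (pi t / 2) ^ 2], and for [x >= 0] the bounds [1 + x <= exp x] and
    [exp (- x) <= 1] give [exp x - exp (- x) >= x]. *)
Lemma ch_ge t : t ^+ 2 / 2 <= ch t - 1.
Proof.
wlog t0 : t / 0 <= t.
  move=> h; have [/h//|t0] := leP 0 t.
  by have := h (- t); rewrite sqrrN chN; apply; lra.
set x := pi * t / 2.
have p2 := pi_ge2 R.
have xt : t <= x by rewrite /x; nra.
have x0 : 0 <= x by exact: le_trans xt.
have e1 := expR_ge1Dx x; have e0 := expR_gt0 x.
have -> : ch t - 1 = (expR x - (expR x)^-1) ^+ 2 / 2.
  rewrite /ch /cosh -expRN.
  have -> : pi * t = x + x by rewrite /x; field.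
  rewrite opprD !expRD.
  have : expR x * expR (- x) = 1 by rewrite -expRD subrr expR0.
  by set a := expR _; set b := expR _ => ab; field: ab.
rewrite ler_wpM2r ?invr_ge0 // ler_sqr ?nnegrE //.
- have : (expR x)^-1 <= 1 by rewrite invf_le1 //; lra.
  lra.
- rewrite subr_ge0; have : (expR x)^-1 <= 1 by rewrite invf_le1 //; lra.
  lra.
Qed.

(** The form in which limits are taken: once with [T] the height of the rectangle, once with [T]
    inverse to the shift [d]. *)
Lemma le_of_le_add_inv (a b K : R) :
  (forall T, 1 <= T -> a <= b + K / T) -> a <= b.
Proof.
move=> h; apply/ler_addgt0Pr => e e0.
pose T := 1 + `|K| / e.
have T1 : 1 <= T by rewrite /T lerDl divr_ge0 // ltW.
apply: le_trans (h T T1) _; rewrite lerD2l ler_pdivrMr; last lra.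
apply: le_trans (ler_norm _) _.
have -> : e * T = e + `|K| by rewrite /T; field; rewrite gt_eqF.
lra.
Qed.

End Elementary.

(** * Boundary derivative of a subharmonic function on the strip *)

Section Core.
Variable R : realType.
Notation mu := (@lebesgue_measure R).
Implicit Types (x y t : R).

Lemma green_err_le (M T : R) : 0 <= M -> 1 <= T ->
  green_err M T <= M * (2 + 6 * pi) / T.
Proof.
move=> M0 T1; rewrite /green_err -[leRHS]mulrA ler_wpM2l //.
have c1 := ch_ge T; have h1 := ch_ge1 T; have p2 := pi_ge2 R.
have T0 : 0 < T by lra.
have sc : `|sh T| <= ch T.
  rewrite -(ler_pXn2r (ltn0Sn 1)) ?nnegrE ?normr_ge0 //; last lra.
  by rewrite real_normK ?num_real // ch2; lra.
set a := ch T - 1 in c1 *.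
have a0 : 0 < a by apply: lt_le_trans c1; rewrite divr_gt0 ?exprn_gt0.
have i0 : 0 < a^-1 by rewrite invr_gt0.
have ia : a^-1 <= 2 / T.
  rewrite -[2 / T]invf_div lef_pV2 ?posrE ?divr_gt0 //.
  by apply: le_trans c1; rewrite ler_pM2r //; nra.
(* Since [|sh T| <= ch T = a + 1], the quotient is at most [a^-1 + a^-2 <= 2 / T + 4 / T ^ 2]. *)
have s2 : `|sh T| / a ^+ 2 <= 6 / T.
  have -> : `|sh T| / a ^+ 2 = `|sh T| * (a^-1 * a^-1).
    by field; rewrite gt_eqF.
  have : `|sh T| * (a^-1 * a^-1) <= ch T * (a^-1 * a^-1).
    by rewrite ler_wpM2r // mulr_ge0 // ltW.
  have -> : ch T * (a^-1 * a^-1) = a^-1 + a^-1 * a^-1.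
    by rewrite /a; field; rewrite gt_eqF.
  have i1 : 0 < T^-1 <= 1 by rewrite invr_gt0 T0 invf_le1.
  nra.
rewrite [leRHS]mulrDl; apply: lerD; first exact: ia.
by rewrite -mulrA (mulrC 6) -[leRHS]mulrA ler_wpM2l ?pi_ge0.
Qed.

(** This is [tanh (pi t / 2) ^ 2], bounded and quadratic at [0]. It is the right weight for errors
    on the line [x = 0]: for [0 < d <= 1 / 2] one has [kap d t * cw t <= d * beta0 t], so such
    errors vanish with [d] in spite of the pole. *)
Definition cw t : R := (ch t - 1) / (ch t + 1).

Lemma cw_ge0 t : 0 <= cw t.
Proof. by have := ch_ge1 t => h; rewrite divr_ge0 //; lra. Qed.

Lemma cw_ge t : t ^+ 2 / (4 + t ^+ 2) <= cw t.
Proof.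
have := ch_ge t; have t2 := sqr_ge0 t; rewrite /cw.
set c := ch t => h.
rewrite ler_pdivrMr; last lra.
rewrite mulrAC ler_pdivlMr; last lra.
nra.
Qed.

Variables (u ux ut uxx utt : R -> R -> R) (M : R).
Hypothesis u_x : forall x t, has_der (u^~ t) x (ux x t).
Hypothesis u_xx : forall x t, has_der (ux^~ t) x (uxx x t).
Hypothesis u_t : forall x t, has_der (u x) t (ut x t).
Hypothesis u_tt : forall x t, has_der (ut x) t (utt x t).
Hypothesis cux : forall x, continuous (ux x).
Hypothesis cuxx : forall x, continuous (uxx x).
Hypothesis cutt : forall x, continuous (utt x).
Hypothesis lap : forall x t, 0 <= uxx x t + utt x t.
Hypothesis bu : forall x t, -1 <= x <= 2 -> `|u x t| <= M.
Hypothesis bux : forall x t, -1 <= x <= 2 -> `|ux x t| <= M.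
Hypothesis but : forall x t, -1 <= x <= 2 -> `|ut x t| <= M.
Hypothesis buxx : forall x t, -1 <= x <= 2 -> `|uxx x t| <= M.
Hypothesis butt : forall x t, -1 <= x <= 2 -> `|utt x t| <= M.
Hypothesis u0_le0 : forall t, u 0 t <= 0.
Hypothesis u00 : u 0 0 = 0.

Let i0 : -1 <= (0 : R) <= 2. Proof. lra. Qed.
Let i1 : -1 <= (1 : R) <= 2. Proof. lra. Qed.
Let M0 : 0 <= M. Proof. exact: le_trans (normr_ge0 _) (bu 0 i0). Qed.

Let cu x : continuous (u x).
Proof. by move=> t; exact: der_cont (u_t x t). Qed.

(** The function [u 0] has a maximum at [0]. This makes it quadratically small there, which matches
    the double pole of [kapy]. *)
Let ut00 : ut 0 0 = 0.
Proof.
have [_ h] : has_der (u 0) 0 0.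
  apply: (@derive1_at_max R (u 0) (-1) 1 0).
  - lra.
  - by move=> t _; case: (u_t 0 t).
  - by rewrite in_itv /=; lra.
  - by move=> t _; rewrite u00 u0_le0.
by case: (u_t 0 0) => _ <-.
Qed.

Let u0_small t : `|u 0 t| <= 5 * M * cw t.
Proof.
have uts y : `|ut 0 y| <= M * `|y|.
  have := @der_lipschitz R (ut 0) (utt 0) M 0 y (u_tt 0).
  by rewrite ut00 !subr0; apply => z _; exact: butt.
have us : `|u 0 t| <= M * t ^+ 2.
  have := @der_lipschitz R (u 0) (ut 0) (M * `|t|) 0 t (u_t 0).
  rewrite u00 !subr0 -mulrA -expr2 real_normK ?num_real //; apply => z zt.
  apply: le_trans (uts z) _; rewrite ler_wpM2l //.
  move: zt; have [t0|t0] := leP 0 t => /andP[z1 z2].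
    by rewrite !ger0_norm.
  by rewrite (ltr0_norm t0) ler0_norm //; lra.
have ub := bu t i0.
have cg := cw_ge t; have t2 := sqr_ge0 t.
(* In both cases the lower bound [cw_ge] yields the constant [5 = 4 + 1]. *)
have [t1|t1] := leP (t ^+ 2) 1.
- apply: le_trans us _; rewrite (mulrC 5) -mulrA ler_wpM2l //.
  have : t ^+ 2 / 5 <= t ^+ 2 / (4 + t ^+ 2).
    by rewrite ler_wpM2l // lef_pV2 ?posrE; lra.
  lra.
- apply: le_trans ub _; rewrite (mulrC 5) -mulrA -[leLHS]mulr1 ler_wpM2l //.
  have : 1 / 5 <= t ^+ 2 / (4 + t ^+ 2).
    by rewrite ler_pdivlMr; lra.
  lra.
Qed.

(** Near [0] continuity of [ux 0] suffices. Away from [0] the weight [cw] is bounded below, so a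
    large multiple of it exceeds [2 * M], the largest possible drop. *)
Let ux0_ge e : 0 < e ->
  exists2 C, 0 <= C & forall t, ux 0 0 - e - C * cw t <= ux 0 t.
Proof.
move=> e0.
have /cvgrPdist_lt/(_ _ e0) := @cux 0 0.
move=> /nbhs_ballP[r /= r0 br].
exists (2 * M * (4 + r ^+ 2) / r ^+ 2).
  by rewrite divr_ge0 ?sqr_ge0 // mulr_ge0 ?mulr_ge0 // addr_ge0 ?sqr_ge0.
move=> t; have [tr|rt] := ltP `|t| r.
  have := br t; rewrite /ball /= sub0r normrN => /(_ tr).
  rewrite ltr_norml => /andP[_ h].
  have : 0 <= 2 * M * (4 + r ^+ 2) / r ^+ 2 * cw t.
    rewrite mulr_ge0 ?cw_ge0 //.
    by rewrite divr_ge0 ?sqr_ge0 // mulr_ge0 ?mulr_ge0 // addr_ge0 ?sqr_ge0.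
  lra.
have := bux t i0; have := bux 0 i0; rewrite !ler_norml => /andP[_ b1] /andP[b2 _].
have r2 : 0 < r ^+ 2 by rewrite exprn_gt0.
have rt2 : r ^+ 2 <= t ^+ 2.
  by rewrite -[t ^+ 2]real_normK ?num_real // ler_sqr ?nnegrE // ltW.
have cg : r ^+ 2 / (4 + r ^+ 2) <= cw t.
  apply: le_trans (cw_ge t).
  move: r2 rt2; move: (r ^+ 2) (t ^+ 2) => a b a0 ab.
  rewrite ler_pdivrMr; last lra.
  rewrite mulrAC ler_pdivlMr; last lra.
  by rewrite !mulrDr (mulrC b a) lerD2r; lra.
have : 2 * M <= 2 * M * (4 + r ^+ 2) / r ^+ 2 * cw t.
  apply: (@le_trans _ _ (2 * M * (4 + r ^+ 2) / r ^+ 2 * (r ^+ 2 / (4 + r ^+ 2)))).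
    have -> : 2 * M * (4 + r ^+ 2) / r ^+ 2 * (r ^+ 2 / (4 + r ^+ 2)) = 2 * M.
      by field; rewrite !gt_eqF //; lra.
    by [].
  rewrite ler_wpM2l //.
  by rewrite divr_ge0 ?sqr_ge0 // mulr_ge0 ?mulr_ge0 // addr_ge0 ?sqr_ge0.
lra.
Qed.

(* With [a = ch t - 1] and [b = 1 - cos (pi d)], the kernel is
   [sin (pi d) / (2 (a + b))]; both estimates follow from [a <= a + b]
   and [b <= sin (pi d) ^ 2]. *)
Let kernel_ge (e C d t : R) : 0 < d <= 1 / 2 -> 0 <= C ->
  (forall t, ux 0 0 - e - C * cw t <= ux 0 t) ->
  - (C * d * beta0 t) <=
    kap d t * (ux 0 t - (ux 0 0 - e - 5 * M * (pi / 2) * (pi * d)))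
    - kapy d t * u 0 t.
Proof.
move=> /andP[d0 d1] C0 /(_ t) uxt.
have p0 := pi_gt0 R; have h1 := ch_ge1 t.
have s0 : 0 < sin (pi * d) :> R.
  by rewrite sin_gt0_pi // mulr_gt0 //= gtr_pMr //; lra.
have s1 : sin (pi * d) <= pi * d :> R by apply: sinpi_le; lra.
have c0 : 0 <= cos (pi * d) :> R.
  by apply: cos_ge0_pihalf; apply/andP; split; nra.
have cs := cos2Dsin2 (pi * d).
have c1 := cos_le1 (pi * d).
have us := u0_small t; have u0 := u0_le0 t.
rewrite (ler0_norm u0) /cw in us.
rewrite /cw in uxt.
rewrite beta0E /kap /kapy /den.
move: uxt us u0 h1 s0 s1 c0 cs c1.
move: (ux 0 t) (ux 0 0) (u 0 t) (ch t) (sin _) (cos _) => U U0 v h s c.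
move=> uxt us u0 h1 s0 s1 c0 cs c1.
have hc : 0 < h - c by nra.
set D := (2 * (h - c))^-1.
have D0 : 0 < D by rewrite invr_gt0 mulr_gt0.
have -> : (2 * ((h - c) * (h - c)))^-1 = 2 * D * D.
  by rewrite /D; field; rewrite gt_eqF.
have DE : D * (h - c) = 1 / 2 by rewrite /D; field; rewrite gt_eqF.
set w := (h - 1) / (h + 1) in uxt us.
have w0 : 0 <= w by rewrite divr_ge0 //; lra.
have wE : w * (h + 1) = h - 1 by rewrite /w; field; rewrite gt_eqF //; lra.
have wh : w <= (h - 1) / 2.
  by rewrite /w ler_wpM2l ?lef_pV2 ?posrE; lra.
have sD0 : 0 <= s * D by rewrite mulr_ge0 ?ltW.
have K1 : s * D * w <= d * (pi / (2 * (h + 1))).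
  have -> : d * (pi / (2 * (h + 1))) = pi * d * (1 / (2 * (h + 1))).
    by field; rewrite gt_eqF //; lra.
  rewrite -mulrA; apply: ler_pM => //; first exact: ltW.
    by rewrite mulr_ge0 // ltW.
  rewrite ler_pdivlMr; last lra.
  have -> : D * w * (2 * (h + 1)) = 2 * (D * (w * (h + 1))) by ring.
  by rewrite wE; nra.
have K2 : - (pi * (c * h - 1) * (2 * D * D)) * v >= - (5 * M * (pi / 2) * (pi * d)) * (s * D).
  have cb : - (1 - c) <= c * h - 1 by nra.
  have b2 : 1 - c <= s ^+ 2 by nra.
  have vM : - v <= 5 * M * ((h - 1) / 2).
    by apply: le_trans us _; rewrite ler_wpM2l // mulr_ge0.
  have D2 : 0 <= pi * (2 * D * D) by rewrite mulr_ge0 ?ltW // !mulr_gt0.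
  have step1 : - (pi * (c * h - 1) * (2 * D * D)) * v >=
      - (pi * (2 * D * D) * (s ^+ 2 * - v)).
    have -> : - (pi * (c * h - 1) * (2 * D * D)) * v =
      pi * (2 * D * D) * ((c * h - 1) * - v) by ring.
    rewrite -mulrN ler_wpM2l //; nra.
  apply: le_trans step1; rewrite mulNr lerN2.
  have -> : 5 * M * (pi / 2) * (pi * d) * (s * D) =
    pi * s * D * (pi * d) * (5 * M * (1 / 2)) by field.
  have -> : pi * (2 * D * D) * (s ^+ 2 * - v) =
    pi * s * D * s * (2 * D * - v) by ring.
  apply: ler_pM.
  - by rewrite !mulr_ge0 // ltW.
  - by apply: mulr_ge0; [exact/ltW/mulr_gt0|lra].
  - by rewrite ler_wpM2l // !mulr_ge0 // ltW.
  apply: (@le_trans _ _ (2 * D * (5 * M * ((h - 1) / 2)))).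
    by rewrite ler_wpM2l // mulr_ge0 // ltW.
  have -> : 2 * D * (5 * M * ((h - 1) / 2)) = 5 * M * (D * (h - 1)) by field.
  rewrite ler_wpM2l ?mulr_ge0 //; nra.
have K3 : - (C * w) * (s * D) <= (U - (U0 - e)) * (s * D).
  by rewrite ler_wpM2r //; lra.
have K4 : - (C * d * (pi / (2 * (h + 1)))) <= - (C * w) * (s * D).
  rewrite mulNr lerN2 (_ : C * w * (s * D) = C * (s * D * w)); last ring.
  by rewrite -(mulrA C) ler_wpM2l.
rewrite -[X in _ <= _ - X]opprK opprK -mulNr.
have -> : s * D * (U - (U0 - e - 5 * M * (pi / 2) * (pi * d))) =
  (U - (U0 - e)) * (s * D) + 5 * M * (pi / 2) * (pi * d) * (s * D) by ring.
lra.
Qed.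


Let I1 := \int[mu]_t (u 1 t * beta0 t).

Let int_u1 : mu.-integrable setT (fun t => (u 1 t * beta0 t)%:E).
Proof. by apply: (@integrable_beta0M _ _ M); [exact: cu|move=> t; exact: bu]. Qed.

Let int_cst (c : R) : mu.-integrable setT (fun t => (c * beta0 t)%:E).
Proof. by apply: (@integrable_beta0M _ (fun=> c) `|c|); [exact: cst_continuous|]. Qed.

Let Rint_cst (c : R) : \int[mu]_t (c * beta0 t) = c.
Proof. exact: Rintegral_beta0M. Qed.

Let B T : R := \int[mu]_(t in `[- T, T]) beta0 t.

Let BE T : 0 < T -> B T = 2 * logistic T - 1.
Proof.
move=> T0; rewrite /B (@Rintegral_FTC _ (@logistic R)).
- by rewrite logisticN; ring.
- by lra.
- exact: der_logistic.
- exact: continuous_beta0.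
Qed.

Let itvE (c : R) T : \int[mu]_(t in `[- T, T]) (c * beta0 t) = c * B T.
Proof.
rewrite RintegralZl //.
exact/integrable_itv/continuous_beta0.
Qed.

(** Adding [M * beta0] makes the integrand nonnegative, so the integral over [[- T, T]] is at most
    the full one. *)
Let I1_ge T : 0 < T ->
  \int[mu]_(t in `[- T, T]) (u 1 t * beta0 t) <= I1 + M * (1 - B T).
Proof.
move=> T0.
have pos t : 0 <= u 1 t * beta0 t + M * beta0 t.
  rewrite -mulrDl mulr_ge0 ?beta0_ge0 //.
  by have := bu t i1; rewrite ler_norml; lra.
have iT : mu.-integrable setT (fun t => (u 1 t * beta0 t + M * beta0 t)%:E).
  rewrite (_ : (fun t => _) = (fun t => (u 1 t * beta0 t)%:E + (M * beta0 t)%:E)%E) //.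
  exact: integrableD.
have mI : measurable (`[- T, T]%classic : set (measurableTypeR R)).
  exact: measurable_itv.
have key : \int[mu]_(t in `[- T, T]) (u 1 t * beta0 t + M * beta0 t) <=
    \int[mu]_t (u 1 t * beta0 t + M * beta0 t).
  apply: fine_le.
  - apply: integrable_fin_num => //.
    exact: integrableS iT.
  - exact: integrable_fin_num.
  - apply: ge0_subset_integral => //.
      exact: measurable_int iT.
    by move=> t _; rewrite lee_fin.
move: key; rewrite RintegralD //; last 2 first.
- exact: integrableS int_u1.
- exact: integrableS (int_cst M).
rewrite itvE (RintegralD measurableT int_u1 (int_cst M)) => h.
have : \int[mu]_(t in `[- T, T]) (u 1 t * beta0 t) + M * B T <= I1 + M.
  by rewrite -[X in I1 + X](Rint_cst M).
lra.
Qed.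

(** Slope of the linear function subtracted from [u] in [core_T]. It falls short of [ux 0 0] by [e],
    for the continuity of [ux 0], and by a multiple of [d] that pays for the [kapy] term in
    [kernel_ge]. *)
Let p e d := ux 0 0 - e - 5 * M * (pi / 2) * (pi * d).

Let core_T (e C d T : R) : 0 < d <= 1 / 2 -> 0 <= C -> 1 <= T ->
  (forall t, ux 0 0 - e - C * cw t <= ux 0 t) ->
  p e d * (1 - d) * B T <=
    I1 + M * (1 - B T) + M * d * B T + C * d * B T + green_err (M + 2 * `|p e d|) T.
Proof.
move=> d01 C0 T1 uxC; set P := p e d.
have dd : 0 < d < 1 by lra.
have T0 : 0 < T by lra.
have chT : 1 < ch T by have := ch_ge T; nra.
(* The function [P * x] is harmonic, vanishes on [x = 0] and is at most [2 * |P|] in modulus on the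
   strip. Subtracting it makes the left integrand of [green] almost nonnegative and produces
   [P * (1 - d)] on the right, which replaces the computation of the mass of [kap d]. Note that
   [ut'] is the modified [u], not a derivative. *)
pose ut' x t := u x t - P * x.
have shiftD (k : R -> R) (k' : R -> R -> R) x t : has_der k x (k' x t) -> has_der (fun z => k z - P * z) x (k' x t - P).
  move=> kx; eapply der_eq.
    by eapply derD; [exact: kx|eapply derN, derM; [exact: derC|exact: derI]].
  by rewrite mul0r add0r mulr1.
have g := @green R ut' (fun x t => ux x t - P) ut uxx utt (M + 2 * `|P|).
have {}g := g (fun x t => shiftD (u^~ t) ux x t (u_x x t)).
have shiftC (k : R -> R) (c a t : R) : has_der k t a -> has_der (fun z => k z - c) t a.
  by move=> kt; eapply der_eq; [eapply derD; [exact: kt|exact: derC]|rewrite addr0].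
have {}g := g (fun x t => shiftC _ P _ _ (u_xx x t)).
have {}g := g (fun x t => shiftC _ (P * x) _ _ (u_t x t)) u_tt.
have {}g := g _ cuxx cutt lap.
have c1 x : continuous (fun t => ux x t - P).
  by move=> t; apply: cvgB; [exact: cux|exact: cvg_cst].
have P0 : 0 <= 2 * `|P| by rewrite mulr_ge0.
have b1 x t : -1 <= x <= 2 -> `|ut' x t| <= M + 2 * `|P|.
  move=> x12; rewrite (le_trans (ler_normB _ _)) // lerD ?bu //.
  by rewrite normrM mulrC ler_wpM2r // ler_norml; lra.
have b2 x t : -1 <= x <= 2 -> `|ut x t| <= M + 2 * `|P|.
  by move=> /(but t); lra.
have b3 x t : -1 <= x <= 2 -> `|uxx x t| <= M + 2 * `|P|.
  by move=> /(buxx t); lra.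
have {g c1 b1 b2 b3} := g c1 b1 b2 b3 d T dd T0 chT.
set L := Rintegral _ _ _; set N := Rintegral _ _ _ => gLN.
have lowL : - (C * d) * B T <= L.
  rewrite -itvE; apply: le_Rintegral.
  - exact: measurable_itv.
  - apply: integrable_itv => t; apply: cvgM; first exact: cvg_cst.
    exact: continuous_beta0.
  - have dn t : den d t != 0.
      by rewrite gt_eqF // (den_gt0 t dd) //; lra.
    apply: integrable_itv => t; apply: cvgB; apply: cvgM.
    + exact: continuous_kap.
    + by apply: cvgB; [exact: cux|exact: cvg_cst].
    + exact: continuous_kapy.
    + by apply: cvgB; [exact: cu|exact: cvg_cst].
  - move=> t _; rewrite mulNr /ut' mulr0 subr0.
    exact: kernel_ge.
have upN : N <= I1 + M * (1 - B T) + (M * d - P * (1 - d)) * B T.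
  rewrite -itvE; apply: (@le_trans _ _
    (\int[mu]_(t in `[- T, T]) (u 1 t * beta0 t + (M * d - P * (1 - d)) * beta0 t))).
    apply: le_Rintegral.
    - exact: measurable_itv.
    - apply: integrable_itv => t; apply: cvgM; first exact: continuous_beta0.
      by apply: cvgB; [exact: cu|exact: cvg_cst].
    - apply: integrable_itv => t; apply: cvgD; apply: cvgM.
      + exact: cu.
      + exact: continuous_beta0.
      + exact: cvg_cst.
      + exact: continuous_beta0.
    - move=> t _; rewrite mulrC -mulrDl ler_wpM2r ?beta0_ge0 // /ut'.
      have := @der_lipschitz R (u^~ t) (ux^~ t) M (1 - d) 1 (fun x => u_x x t).
      have d0 : 0 <= d by lra.
      rewrite (_ : 1 - (1 - d) = d); last ring.
      rewrite (ger0_norm d0) => /(_ _) h.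
      have : `|u 1 t - u (1 - d) t| <= M * d.
        apply: h => x; rewrite (min_idPl _) ?(max_idPr _) ?lerBlDr ?lerDl //.
        by move=> xd; apply: bux; lra.
      rewrite ler_norml; lra.
  rewrite RintegralD //; last 2 first.
  - by apply: integrableS int_u1 => //; exact: measurable_itv.
  - by apply: integrableS (int_cst _) => //; exact: measurable_itv.
  by rewrite lerD2r; exact: I1_ge.
lra.
Qed.


Lemma core_le : ux 0 0 <= I1.
Proof.
have p0 := pi_gt0 R.
apply/ler_addgt0Pr => e e0.
have [C C0 uxC] := ux0_ge e0.
(* The claim [key] is the inequality after the limit in [T]. To let [d] tend to [0], it is used at
   [T^-1 / 2] for a fresh [T >= 1]. *)
suff key d : 0 < d <= 1 / 2 -> p e d * (1 - d) <= I1 + M * d + C * d.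
  pose q := ux 0 0 - e; pose A := 5 * M * (pi / 2) * pi.
  have A0 : 0 <= A.
    apply: mulr_ge0; last exact: ltW.
    by apply: mulr_ge0; [exact: mulr_ge0|rewrite divr_ge0 // ltW].
  rewrite -lerBlDr; apply: (@le_of_le_add_inv _ _ _ (M + C + A + `|q|)) => T T1.
  have i01 : 0 < T^-1 <= 1.
    have T0 : 0 < T by lra.
    by rewrite invr_gt0 T0 invf_le1.
  have := key (T^-1 / 2).
  move: i01; set d := T^-1; move=> /andP[d0 d1] keyd.
  have {keyd} := keyd ltac:(lra).
  have -> : p e (d / 2) = q - A * (d / 2) by rewrite /p /q /A; ring.
  have := ler_norm q; have := normr_ge0 q.
  move: (`|q|) => nq nq0 qn h.
  have h1 : 0 <= A * (d / 2) * (d / 2) by rewrite !mulr_ge0 //; lra.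
  have h2 : q * (d / 2) <= nq * d by nra.
  have h3 : 0 <= M * d by rewrite mulr_ge0 // ltW.
  have h4 : 0 <= C * d by rewrite mulr_ge0 // ltW.
  have h5 : 0 <= A * d by rewrite mulr_ge0 // ltW.
  rewrite -/q; lra.
move=> d01.
(* The first two terms come from [1 - B T <= 2 / T], the last from [green_err_le]. *)
pose K := `|p e d| * 2 + 2 * M + (M + 2 * `|p e d|) * (2 + 6 * pi).
apply: (@le_of_le_add_inv _ _ _ K) => T T1.
have core := core_T d01 C0 T1 uxC.
have T0 : 0 < T by lra.
have B1 : B T <= 1 by rewrite BE //; have := logistic_le1 T; lra.
have B0 : 1 - 2 * T^-1 <= B T by rewrite BE //; have := logistic_ge T0; lra.
have P0 := normr_ge0 (p e d).
have P1 := ler_norm (p e d).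
have MP : 0 <= M + 2 * `|p e d| by rewrite addr_ge0 // mulr_ge0.
have errle := green_err_le MP T1.
have [d0 d1] := andP d01.
have Ti : 0 <= T^-1 by rewrite invr_ge0 ltW.
have alg (nP P b r I E err : R) : 0 <= nP -> P <= nP -> b <= 1 ->
    1 - 2 * r <= b -> err <= E * r -> 0 <= r ->
    P * (1 - d) * b <= I + M * (1 - b) + M * d * b + C * d * b + err ->
    P * (1 - d) <= I + M * d + C * d + (nP * 2 + 2 * M + E) * r.
  move=> nP0 PnP b1 b0 errE r0 h.
  have h1 : P * (1 - d) * (1 - b) <= nP * (2 * r).
    have b10 : 0 <= 1 - b by lra.
    have b20 : 1 - b <= 2 * r by lra.
    apply: (@le_trans _ _ (nP * (1 - b))); last by rewrite ler_wpM2l.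
    rewrite ler_wpM2r //; nra.
  have h2 : M * (1 - b) <= M * (2 * r) by rewrite ler_wpM2l //; lra.
  have h3 : M * d * b <= M * d.
    by rewrite -[leRHS]mulr1 ler_wpM2l // mulr_ge0 // ltW.
  have h4 : C * d * b <= C * d.
    by rewrite -[leRHS]mulr1 ler_wpM2l // mulr_ge0 // ltW.
  lra.
exact: (alg _ _ _ _ _ _ _ P0 P1 B1 B0 errle Ti core).
Qed.

End Core.

(** * Subharmonicity of the logarithm of an exponential sum *)

Section ExpSum.
Variable R : realType.
Notation mu := (@lebesgue_measure R).
Implicit Types (s : seq (R * (R * R))) (x t : R).

(* [(mu, (alpha, beta))] stands for [(alpha + i beta) e^(mu z)] with [z = x + it]. *)
Definition eterm_re (w : R * (R * R)) x t : R :=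
  expR (w.1 * x) * (w.2.1 * cos (w.1 * t) - w.2.2 * sin (w.1 * t)).
Definition eterm_im (w : R * (R * R)) x t : R :=
  expR (w.1 * x) * (w.2.1 * sin (w.1 * t) + w.2.2 * cos (w.1 * t)).
Definition esum_re s x t : R := \sum_(w <- s) eterm_re w x t.
Definition esum_im s x t : R := \sum_(w <- s) eterm_im w x t.
Definition esum_der s := [seq (w.1, (w.1 * w.2.1, w.1 * w.2.2)) | w <- s].

Lemma derSum (W : Type) (r : seq W) (F : W -> R -> R) (F' : W -> R) x :
  (forall w, has_der (F w) x (F' w)) ->
  has_der (fun y => \sum_(w <- r) F w y) x (\sum_(w <- r) F' w).
Proof.
move=> dF; elim: r => [|w r IH].
  rewrite big_nil (_ : (fun y => _) = fun=> 0); first exact: derC.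
  by apply/funext => y; rewrite big_nil.
rewrite big_cons (_ : (fun y => _) = fun y => F w y + \sum_(w <- r) F w y).
  by apply: derD.
by apply/funext => y; rewrite big_cons.
Qed.

Let derlin (c x : R) : has_der (fun y => c * y) x c.
Proof.
by eapply der_eq; [eapply derM; [exact: derC|exact: derI]|rewrite mul0r add0r mulr1].
Qed.

Let derexp (c x : R) : has_der (fun y => expR (c * y)) x (expR (c * x) * c).
Proof. by eapply derComp; [exact: is_derive_expR|exact: derlin]. Qed.

Let dercos (c x : R) : has_der (fun y => cos (c * y)) x (- sin (c * x) * c).
Proof. by eapply derComp; [exact: is_derive_cos|exact: derlin]. Qed.

Let dersin (c x : R) : has_der (fun y => sin (c * y)) x (cos (c * x) * c).
Proof. by eapply derComp; [exact: is_derive_sin|exact: derlin]. Qed.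

Lemma esum_re_derx s x t : has_der (esum_re s ^~ t) x (esum_re (esum_der s) x t).
Proof.
rewrite /esum_re big_map; apply: derSum => w; rewrite /eterm_re /=.
by eapply der_eq; [eapply derM; [exact: derexp|exact: derC]|rewrite /=; ring].
Qed.

Lemma esum_im_derx s x t : has_der (esum_im s ^~ t) x (esum_im (esum_der s) x t).
Proof.
rewrite /esum_im big_map; apply: derSum => w; rewrite /eterm_im /=.
by eapply der_eq; [eapply derM; [exact: derexp|exact: derC]|rewrite /=; ring].
Qed.

(** Differentiation in [t] multiplies the complex derivative by [i], which swaps real and imaginary
    parts up to sign. *)
Lemma esum_re_dert s x t : has_der (esum_re s x) t (- esum_im (esum_der s) x t).
Proof.
rewrite /esum_re /esum_im big_map -sumrN; apply: derSum => w.
rewrite /eterm_re /eterm_im /=; eapply der_eq.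
  eapply derM; first exact: derC.
  eapply derD; [|eapply derN]; eapply derM.
  - exact: derC.
  - exact: dercos.
  - exact: derC.
  - exact: dersin.
by rewrite /=; ring.
Qed.

Lemma esum_im_dert s x t : has_der (esum_im s x) t (esum_re (esum_der s) x t).
Proof.
rewrite /esum_re /esum_im big_map; apply: derSum => w.
rewrite /eterm_re /eterm_im /=; eapply der_eq.
  eapply derM; first exact: derC.
  eapply derD; eapply derM.
  - exact: derC.
  - exact: dersin.
  - exact: derC.
  - exact: dercos.
by rewrite /=; ring.
Qed.

(** On the strip [-1 <= x <= 2] one has [|x| <= 2], and real frequencies leave only sines and
    cosines of [t]; hence a bound uniform in [t]. *)
Definition esum_bound s : R :=
  \sum_(w <- s) expR (2 * `|w.1|) * (`|w.2.1| + `|w.2.2|).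

Lemma expR_strip (c x : R) : -1 <= x <= 2 -> expR (c * x) <= expR (2 * `|c|).
Proof.
move=> x12; rewrite ler_expR; apply: le_trans (ler_norm _) _.
by rewrite normrM mulrC ler_wpM2r // ler_norml; lra.
Qed.

Lemma esum_re_le s x t : -1 <= x <= 2 -> `|esum_re s x t| <= esum_bound s.
Proof.
move=> x12; apply: le_trans (ler_norm_sum _ _ _) _.
apply: ler_sum => w _; rewrite normrM (ger0_norm (expR_ge0 _)).
rewrite ler_pM ?expR_ge0 ?normr_ge0 ?expR_strip //.
rewrite (le_trans (ler_normB _ _)) // !normrM lerD //.
  by rewrite -[leRHS]mulr1 ler_wpM2l // cos_max.
by rewrite -[leRHS]mulr1 ler_wpM2l // sin_max.
Qed.

Lemma esum_im_le s x t : -1 <= x <= 2 -> `|esum_im s x t| <= esum_bound s.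
Proof.
move=> x12; apply: le_trans (ler_norm_sum _ _ _) _.
apply: ler_sum => w _; rewrite normrM (ger0_norm (expR_ge0 _)).
rewrite ler_pM ?expR_ge0 ?normr_ge0 ?expR_strip //.
rewrite (le_trans (ler_normD _ _)) // !normrM lerD //.
  by rewrite -[leRHS]mulr1 ler_wpM2l // sin_max.
by rewrite -[leRHS]mulr1 ler_wpM2l // cos_max.
Qed.

Variables (s : seq (R * (R * R))) (e : R).
Hypothesis e0 : 0 < e.

Let p := esum_re s.
Let q := esum_im s.
Let p1 := esum_re (esum_der s).
Let q1 := esum_im (esum_der s).
Let p2 := esum_re (esum_der (esum_der s)).
Let q2 := esum_im (esum_der (esum_der s)).
Let g x t := p x t * p x t + q x t * q x t + e.

(** The regularization of [log |phi|]. Subtracting [ln (1 + e)] makes it [0] where [phi = 1] and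
    nonpositive where [|phi| <= 1]. *)
Definition logmod x t : R := (ln (g x t) - ln (1 + e)) * 2^-1.
Let ux x t := (p x t * p1 x t + q x t * q1 x t) * (g x t)^-1.
Let ut x t := (q x t * p1 x t - p x t * q1 x t) * (g x t)^-1.
Let uxx x t := (p1 x t * p1 x t + q1 x t * q1 x t + p x t * p2 x t + q x t * q2 x t) * (g x t)^-1
  - 2 * ((p x t * p1 x t + q x t * q1 x t) * (p x t * p1 x t + q x t * q1 x t)) * ((g x t)^-1 * (g x t)^-1).
Let utt x t := (p1 x t * p1 x t + q1 x t * q1 x t - p x t * p2 x t - q x t * q2 x t) * (g x t)^-1
  - 2 * ((q x t * p1 x t - p x t * q1 x t) * (q x t * p1 x t - p x t * q1 x t)) * ((g x t)^-1 * (g x t)^-1).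

Let g_ge x t : e <= g x t.
Proof. by rewrite /g lerDr addr_ge0 // -expr2 sqr_ge0. Qed.

Let g_gt0 x t : 0 < g x t. Proof. exact: lt_le_trans e0 (g_ge x t). Qed.
Let g_neq0 x t : g x t != 0. Proof. by rewrite gt_eqF. Qed.

Let g_x x t : has_der (g^~ t) x (2 * (p x t * p1 x t + q x t * q1 x t)).
Proof.
eapply der_eq.
  eapply derD; last exact: derC.
  by eapply derD; eapply derM; (exact: esum_re_derx || exact: esum_im_derx).
by rewrite /p /q /p1 /q1; ring.
Qed.

Let g_t x t : has_der (g x) t (2 * (q x t * p1 x t - p x t * q1 x t)).
Proof.
eapply der_eq.
  eapply derD; last exact: derC.
  by eapply derD; eapply derM; (exact: esum_re_dert || exact: esum_im_dert).
by rewrite /p /q /p1 /q1; ring.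
Qed.

Let u_x x t : has_der (logmod^~ t) x (ux x t).
Proof.
eapply der_eq.
  eapply derM; last exact: derC.
  eapply derD; last exact: derC.
  eapply derComp; last exact: g_x.
  exact: is_derive1_ln.
rewrite /ux; have := g_neq0 x t; set G := g x t => G0.
by rewrite /=; field.
Qed.

Let u_t x t : has_der (logmod x) t (ut x t).
Proof.
eapply der_eq.
  eapply derM; last exact: derC.
  eapply derD; last exact: derC.
  eapply derComp; last exact: g_t.
  exact: is_derive1_ln.
rewrite /ut; have := g_neq0 x t; set G := g x t => G0.
by rewrite /=; field.
Qed.

Let u_xx x t : has_der (ux^~ t) x (uxx x t).
Proof.
eapply der_eq.
  eapply derM.
    by eapply derD; eapply derM; (exact: esum_re_derx || exact: esum_im_derx).
  by eapply derV; [exact: g_neq0|exact: g_x].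
rewrite /uxx -/p -/q -/p1 -/q1 -/p2 -/q2; have := g_neq0 x t; set G := g x t => G0.
by rewrite /=; field.
Qed.

Let u_tt x t : has_der (ut x) t (utt x t).
Proof.
eapply der_eq.
  eapply derM.
    by eapply derD; [|eapply derN]; eapply derM; (exact: esum_re_dert || exact: esum_im_dert).
  by eapply derV; [exact: g_neq0|exact: g_t].
rewrite /utt -/p -/q -/p1 -/q1 -/p2 -/q2; have := g_neq0 x t; set G := g x t => G0.
by rewrite /=; field.
Qed.

(** For holomorphic [phi] the Laplacian of [log (|phi|^2 + e) / 2] is
    [2 e |phi'|^2 / (|phi|^2 + e)^2]. *)
Let lap x t : 0 <= uxx x t + utt x t.
Proof.
have G0 := g_neq0 x t.
have -> : uxx x t + utt x t =
    2 * e * (p1 x t * p1 x t + q1 x t * q1 x t) * ((g x t)^-1 * (g x t)^-1).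
  by rewrite /uxx /utt; move: G0; rewrite /g => G0; field.
have s1 : 0 <= p1 x t * p1 x t + q1 x t * q1 x t.
  by apply: addr_ge0; rewrite -expr2 sqr_ge0.
have s2 : 0 <= (g x t)^-1 * (g x t)^-1 by rewrite -expr2 sqr_ge0.
have s3 : 0 <= 2 * e by rewrite mulr_ge0 // ltW.
by rewrite mulr_ge0 // mulr_ge0.
Qed.

Let K := esum_bound s + esum_bound (esum_der s) + esum_bound (esum_der (esum_der s)).

Let bound_ge0 r : 0 <= esum_bound r.
Proof.
by apply: sumr_ge0 => w _; rewrite mulr_ge0 ?expR_ge0 // addr_ge0.
Qed.

Let cre r x : continuous (esum_re r x).
Proof. by move=> t; exact: der_cont (esum_re_dert r x t). Qed.

Let cim r x : continuous (esum_im r x).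
Proof. by move=> t; exact: der_cont (esum_im_dert r x t). Qed.

Let cp x : continuous (p x). Proof. exact: cre. Qed.
Let cq x : continuous (q x). Proof. exact: cim. Qed.
Let cp1 x : continuous (p1 x). Proof. exact: cre. Qed.
Let cq1 x : continuous (q1 x). Proof. exact: cim. Qed.
Let cp2 x : continuous (p2 x). Proof. exact: cre. Qed.
Let cq2 x : continuous (q2 x). Proof. exact: cim. Qed.

Let cginv x : continuous (fun t => (g x t)^-1).
Proof.
move=> t; apply: cvgV; first exact: g_neq0.
exact: der_cont (g_t x t).
Qed.

Let cnx x : continuous (fun t => p x t * p1 x t + q x t * q1 x t).
Proof.
move=> t; apply: cvgD; apply: cvgM; [exact: cp|exact: cp1|exact: cq|exact: cq1].
Qed.

Let cnt x : continuous (fun t => q x t * p1 x t - p x t * q1 x t).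
Proof.
move=> t; apply: cvgB; apply: cvgM; [exact: cq|exact: cp1|exact: cp|exact: cq1].
Qed.

Let cn1 x : continuous (fun t => p1 x t * p1 x t + q1 x t * q1 x t).
Proof.
move=> t; apply: cvgD; apply: cvgM; [exact: cp1|exact: cp1|exact: cq1|exact: cq1].
Qed.

Let cpp x : continuous (fun t => p x t * p2 x t).
Proof. by move=> t; apply: cvgM; [exact: cp|exact: cp2]. Qed.

Let cqq x : continuous (fun t => q x t * q2 x t).
Proof. by move=> t; apply: cvgM; [exact: cq|exact: cq2]. Qed.

Let cux x : continuous (ux x).
Proof. by move=> t; apply: cvgM; [exact: cnx|exact: cginv]. Qed.

Let cuxx x : continuous (uxx x).
Proof.
move=> t; apply: cvgB; apply: cvgM.
- apply: cvgD; last exact: cqq.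
  by apply: cvgD; [exact: cn1|exact: cpp].
- exact: cginv.
- apply: cvgM; first exact: cvg_cst.
  by apply: cvgM; exact: cnx.
- by apply: cvgM; exact: cginv.
Qed.

Let cutt x : continuous (utt x).
Proof.
move=> t; apply: cvgB; apply: cvgM.
- apply: cvgB; last exact: cqq.
  by apply: cvgB; [exact: cn1|exact: cpp].
- exact: cginv.
- apply: cvgM; first exact: cvg_cst.
  by apply: cvgM; exact: cnt.
- by apply: cvgM; exact: cginv.
Qed.

Lemma continuous_logmod x : continuous (logmod x).
Proof. by move=> t; exact: der_cont (u_t x t). Qed.

(* All five functions are polynomials in bounded functions and [1 / g <= 1 / e]. *)
Lemma logmod_bounded : exists M : R, forall x t, -1 <= x <= 2 ->
  [/\ `|logmod x t| <= M, `|ux x t| <= M, `|ut x t| <= M,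
      `|uxx x t| <= M & `|utt x t| <= M].
Proof.
pose i := e^-1.
have i0 : 0 <= i by rewrite invr_ge0 ltW.
have K0 : 0 <= K by rewrite !addr_ge0.
pose L := `|ln e| + `|ln (K * K + K * K + e)| + `|ln (1 + e)|.
exists (L + 2 * (K * K) * i + (4 * (K * K) * i + 8 * (K * K * (K * K)) * (i * i))).
move=> x t x12.
have b1 := bound_ge0 s; have b2 := bound_ge0 (esum_der s).
have b3 := bound_ge0 (esum_der (esum_der s)).
have p_ : `|p x t| <= K by have := esum_re_le s t x12; rewrite /p /K; lra.
have q_ : `|q x t| <= K by have := esum_im_le s t x12; rewrite /q /K; lra.
have p1_ : `|p1 x t| <= K by have := esum_re_le (esum_der s) t x12; rewrite /p1 /K; lra.
have q1_ : `|q1 x t| <= K by have := esum_im_le (esum_der s) t x12; rewrite /q1 /K; lra.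
have p2_ : `|p2 x t| <= K.
  by have := esum_re_le (esum_der (esum_der s)) t x12; rewrite /p2 /K; lra.
have q2_ : `|q2 x t| <= K.
  by have := esum_im_le (esum_der (esum_der s)) t x12; rewrite /q2 /K; lra.
have gi : `|(g x t)^-1| <= i.
  by rewrite gtr0_norm ?invr_gt0 // lef_pV2 ?posrE.
have m2 (a b A B : R) : `|a| <= A -> `|b| <= B -> `|a * b| <= A * B.
  by move=> aA bB; rewrite normrM ler_pM.
have a2 (a b A B : R) : `|a| <= A -> `|b| <= B -> `|a + b| <= A + B.
  by move=> aA bB; rewrite (le_trans (ler_normD _ _)) // lerD.
have s2 (a b A B : R) : `|a| <= A -> `|b| <= B -> `|a - b| <= A + B.
  by move=> aA bB; rewrite (le_trans (ler_normB _ _)) // lerD.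
have t2 (a A : R) : `|a| <= A -> `|2 * a| <= 2 * A.
  by move=> aA; rewrite normrM ger0_norm // ler_wpM2l.
have KK : 0 <= K * K by rewrite mulr_ge0.
have L0 : 0 <= L by rewrite !addr_ge0.
have X0 : 0 <= K * K * i by rewrite mulr_ge0.
have Y0 : 0 <= K * K * (K * K) * (i * i) by rewrite !mulr_ge0.
have pq : `|p x t * p1 x t + q x t * q1 x t| <= K * K + K * K.
  by apply: (a2); exact: (m2).
have pq' : `|q x t * p1 x t - p x t * q1 x t| <= K * K + K * K.
  by apply: (s2); exact: (m2).
have ux_ : `|ux x t| <= (K * K + K * K) * i by exact: (m2).
have ut_ : `|ut x t| <= (K * K + K * K) * i by exact: (m2).
have uxx_ : `|uxx x t| <= (K * K + K * K + K * K + K * K) * i +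
    2 * ((K * K + K * K) * (K * K + K * K)) * (i * i).
  apply: (s2); apply: (m2) => //; [|by apply: (t2); exact: (m2)|exact: (m2)].
  by do 3 (try apply: (a2)); exact: (m2).
have utt_ : `|utt x t| <= (K * K + K * K + K * K + K * K) * i +
    2 * ((K * K + K * K) * (K * K + K * K)) * (i * i).
  apply: (s2); apply: (m2) => //; [|by apply: (t2); exact: (m2)|exact: (m2)].
  by apply: (s2); [apply: (s2); [apply: (a2)|]|]; exact: (m2).
have lg : `|logmod x t| <= L.
  have h1 : ln e <= ln (g x t) by rewrite ler_ln ?posrE.
  have h2 : ln (g x t) <= ln (K * K + K * K + e).
    rewrite ler_ln ?posrE // ?ltr_wpDl ?addr_ge0 // /g lerD2r.
    by apply: lerD; apply: le_trans (ler_norm _) _; exact: (m2).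
  have lg : `|ln (g x t)| <= `|ln e| + `|ln (K * K + K * K + e)|.
    rewrite ler_norml; apply/andP; split.
      by have := ler_norm (- ln e); rewrite normrN; have := normr_ge0 (ln (K * K + K * K + e)); lra.
    by have := ler_norm (ln (K * K + K * K + e)); have := normr_ge0 (ln e); lra.
  rewrite /logmod normrM (ger0_norm (_ : 0 <= 2^-1)); last by rewrite invr_ge0.
  have := ler_normB (ln (g x t)) (ln (1 + e)).
  have := normr_ge0 (ln (g x t) - ln (1 + e)).
  by rewrite /L; lra.
split; [lra|lra|lra| |].
- by apply: le_trans uxx_ _; lra.
- by apply: le_trans utt_ _; lra.
Qed.

Hypothesis unit_line : forall t, p 0 t ^+ 2 + q 0 t ^+ 2 <= 1.
Hypothesis re00 : p 0 0 = 1.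
Hypothesis im00 : q 0 0 = 0.

(** As [phi(0) = 1], the [x]-derivative of [logmod] at the origin is the real part of [phi'(0)]
    divided by [1 + e]. *)
Lemma esum_core :
  p1 0 0 / (1 + e) <= \int[mu]_t (logmod 1 t * beta0 t).
Proof.
have [M bM] := logmod_bounded.
have g00 : g 0 0 = 1 + e by rewrite /g re00 im00; ring.
have -> : p1 0 0 / (1 + e) = ux 0 0 by rewrite /ux g00 re00 im00; ring.
apply: (@core_le _ logmod ux ut uxx utt M) => //.
- by move=> x t /(bM x t) [].
- by move=> x t /(bM x t) [].
- by move=> x t /(bM x t) [].
- by move=> x t /(bM x t) [].
- by move=> x t /(bM x t) [].
- move=> t; rewrite /logmod pmulr_lle0 ?invr_gt0 // subr_le0 ler_ln ?posrE //.
    by rewrite /g lerD2r -!expr2.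
  by rewrite addr_gt0.
- by rewrite /logmod g00 subrr mul0r.
Qed.

End ExpSum.

(** * Determinants of compressions *)

Section DetInequality.
Variable C : numClosedFieldType.
Implicit Types m n k : nat.

Definition adjmx m n (A : 'M[C]_(m, n)) : 'M[C]_(n, m) := map_mx Num.conj A^T.
Local Notation "A ^H" := (adjmx A) (at level 8, format "A ^H").

Lemma adjmxE m n (A : 'M[C]_(m, n)) i j : A^H i j = (A j i)^*.
Proof. by rewrite !mxE. Qed.

Lemma adjmxM m n k (A : 'M[C]_(m, n)) (B : 'M[C]_(n, k)) :
  (A *m B)^H = B^H *m A^H.
Proof. by rewrite /adjmx trmx_mul map_mxM. Qed.

Lemma adjmxK m n (A : 'M[C]_(m, n)) : A^H^H = A.
Proof. by apply/matrixP => i j; rewrite !mxE conjCK. Qed.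

Lemma adjmxB m n (A B : 'M[C]_(m, n)) : (A - B)^H = A^H - B^H.
Proof. by apply/matrixP => i j; rewrite !mxE rmorphB. Qed.

Lemma adjmx1 n : (1%:M : 'M[C]_n)^H = 1%:M.
Proof. by rewrite /adjmx trmx1 map_mx1. Qed.

Lemma adjmx_diag n (d : 'rV[C]_n) : (diag_mx d)^H = diag_mx (map_mx Num.conj d).
Proof. by rewrite /adjmx tr_diag_mx map_diag_mx. Qed.

Lemma det_adjmx n (A : 'M[C]_n) : \det (A^H) = (\det A)^*.
Proof. by rewrite /adjmx det_map_mx det_tr. Qed.

Lemma adjmx_col_mul m1 m2 n (A : 'M[C]_(m1, n)) (B : 'M[C]_(m2, n)) :
  (col_mx A B)^H *m col_mx A B = A^H *m A + B^H *m B.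
Proof. by rewrite /adjmx tr_col_mx map_row_mx mul_row_col. Qed.

Lemma gram_mul m n k (A : 'M[C]_(m, n)) (B : 'M[C]_(n, k)) :
  (A *m B)^H *m (A *m B) = B^H *m (A^H *m A) *m B.
Proof. by rewrite adjmxM !mulmxA. Qed.

Lemma hermitian_spectral n (A : 'M[C]_n) : A^H = A ->
  exists2 W : 'M[C]_n, W^H *m W = 1%:M & exists2 d : 'rV[C]_n,
    (forall i, d 0 i \is Num.real) & A = W *m diag_mx d *m W^H.
Proof.
move=> hA.
have hs : A \is hermsymmx.
  apply/is_hermitianmxP; rewrite expr0 scale1r.
  by rewrite -[LHS]hA.
have /orthomx_spectralP := hermitian_normalmx hs.
have /unitarymxP uP := spectral_unitarymx A.
have iP := invmx_unitary (spectral_unitarymx A).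
rewrite iP => eA.
exists (spectralmx A)^H.
  by rewrite adjmxK.
exists (spectral_diag A).
  by move=> i; have /mxOverP := hermitian_spectral_diag_real hs; apply.
by rewrite adjmxK {1}eA.
Qed.

Lemma gram_entry m n (A : 'M[C]_(m, n)) i :
  (A^H *m A) i i = \sum_j `|A j i| ^+ 2.
Proof.
by rewrite mxE; apply: eq_bigr => j _; rewrite adjmxE normCK mulrC.
Qed.

Lemma unitary_rev n (W : 'M[C]_n) : W^H *m W = 1%:M -> W *m W^H = 1%:M.
Proof. exact: mulmx1C. Qed.

Lemma gram_spectral m n (A : 'M[C]_(m, n)) :
  exists2 W : 'M[C]_n, W^H *m W = 1%:M & exists2 d : 'rV[C]_n,
    (forall i, 0 <= d 0 i) & A^H *m A = W *m diag_mx d *m W^H.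
Proof.
have hA : (A^H *m A)^H = A^H *m A by rewrite adjmxM adjmxK.
have [W uW [d _ eA]] := hermitian_spectral hA.
exists W => //; exists d => // i.
(* The eigenvalues are the squared column norms of [A *m W]. *)
have eD : (A *m W)^H *m (A *m W) = diag_mx d.
  by rewrite adjmxM mulmxA -(mulmxA _ _ A) eA !mulmxA uW mul1mx -mulmxA uW mulmx1.
have -> : d 0 i = ((A *m W)^H *m (A *m W)) i i by rewrite eD mxE eqxx.
by rewrite gram_entry sumr_ge0 // => j _; rewrite exprn_ge0.
Qed.

Lemma det_conj_unitary n (W D : 'M[C]_n) : W^H *m W = 1%:M ->
  \det (W *m D *m W^H) = \det D.
Proof.
move=> uW; rewrite !det_mulmx mulrAC -det_mulmx.
by rewrite (unitary_rev uW) det1 mul1r.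
Qed.

Lemma det_diagD1 n (d : 'rV[C]_n) :
  \det (1%:M + diag_mx d) = \prod_i (1 + d 0 i).
Proof.
have -> : 1%:M + diag_mx d = diag_mx (const_mx 1 + d).
  by rewrite linearD /= diag_const_mx.
by rewrite det_diag; apply: eq_bigr => i _; rewrite !mxE.
Qed.

Lemma det_gramD1_ge1 m n (A : 'M[C]_(m, n)) : 1 <= \det (1%:M + A^H *m A).
Proof.
have [W uW [d d0 ->]] := gram_spectral A.
have -> : 1%:M + W *m diag_mx d *m W^H = W *m (1%:M + diag_mx d) *m W^H.
  by rewrite mulmxDr mulmxDl mulmx1 (unitary_rev uW).
rewrite det_conj_unitary // det_diagD1.
elim/big_rec: _ => // i x _ x1.
by rewrite -[X in X <= _]mulr1 ler_pM ?ler01 // lerDl.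
Qed.

Lemma det_gram_ge0 m n (A : 'M[C]_(m, n)) : 0 <= \det (A^H *m A).
Proof.
have [W uW [d d0 ->]] := gram_spectral A.
by rewrite det_conj_unitary // det_diag prodr_ge0.
Qed.

(** If [A^H *m A] is singular the left side is [0]. Otherwise it is [B^H *m B] with [B] invertible,
    and factoring [B] out of the right side leaves [1] plus a Gram matrix, of determinant at least
    [1]. *)
Lemma det_gramD_ge m m' n (A : 'M[C]_(m, n)) (E : 'M[C]_(m', n)) :
  \det (A^H *m A) <= \det (A^H *m A + E^H *m E).
Proof.
have [W uW [d d0 eA]] := gram_spectral A.
have [d00|/existsPn dn0] := boolP [exists i, d 0 i == 0].
  have -> : \det (A^H *m A) = 0.
    have /existsP[i /eqP di] := d00.
    by rewrite eA det_conj_unitary // det_diag (bigD1 i) //= di mul0r.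
  by rewrite -adjmx_col_mul det_gram_ge0.
pose r : 'rV[C]_n := \row_i sqrtC (d 0 i).
have r0 i : 0 < r 0 i by rewrite mxE sqrtC_gt0 lt0r dn0 d0.
pose B := diag_mx r *m W^H.
have rH : (diag_mx r)^H = diag_mx r.
  rewrite adjmx_diag; congr diag_mx; apply/rowP => i; rewrite mxE.
  by rewrite geC0_conj // ltW.
have BB : B^H *m B = A^H *m A.
  rewrite /B adjmxM adjmxK rH mulmxA -(mulmxA W) mulmx_diag eA.
  congr (_ *m diag_mx _ *m _); apply/rowP => i.
  by rewrite !mxE -expr2 sqrtCK.
have uB : B \in unitmx.
  rewrite unitmx_mul; apply/andP; split.
    rewrite unitmxE det_diag unitfE; apply/prodf_neq0 => i _.
    by rewrite gt_eqF.
  by have [] := mulmx1_unit uW.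
rewrite -BB.
have iB : B *m invmx B = 1%:M by rewrite mulmxV.
have eB : B^H *m B + E^H *m E =
    B^H *m (1%:M + (E *m invmx B)^H *m (E *m invmx B)) *m B.
  rewrite mulmxDr mulmxDl mulmx1; congr (_ + _).
  have eE : E = E *m invmx B *m B by rewrite mulmxKV.
  by rewrite {1 2}eE !adjmxM !mulmxA.
rewrite eB [leRHS]det_mulmx [X in _ <= X * _]det_mulmx mulrAC -det_mulmx.
rewrite -[X in X <= _]mulr1 ler_wpM2l ?det_gram_ge0 //.
exact: det_gramD1_ge1.
Qed.

(** Sylvester's identity: the block matrix [X] is made triangular in two ways by unipotent
    factors. *)
Lemma det_1D_mulC m n (A : 'M[C]_(m, n)) (B : 'M[C]_(n, m)) :
  \det (1%:M + A *m B) = \det (1%:M + B *m A).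
Proof.
pose X := block_mx 1%:M (- A) B 1%:M.
have e1 : X *m block_mx 1%:M A 0 1%:M = block_mx 1%:M 0 B (1%:M + B *m A).
  by rewrite mulmx_block !mulmx1 !mulmx0 !addr0 mul1mx subrr addrC.
have e2 : X *m block_mx 1%:M 0 (- B) 1%:M = block_mx (1%:M + A *m B) (- A) 0 1%:M.
  by rewrite mulmx_block !mulmx1 !mulmx0 !add0r mul1mx subrr mulNmx mulmxN opprK.
have := congr1 determinant e1; have := congr1 determinant e2.
rewrite !det_mulmx !(det_lblock, det_ublock) !det1 !mulr1 !mul1r.
by move=> <- <-.
Qed.


(* [1 - Y Y^H] is an orthogonal projection *)
Lemma isometry_split m n k (Y : 'M[C]_(m, n)) (N : 'M[C]_(m, k)) :
  Y^H *m Y = 1%:M ->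
  (Y^H *m N)^H *m (Y^H *m N) +
    ((1%:M - Y *m Y^H) *m N)^H *m ((1%:M - Y *m Y^H) *m N) = N^H *m N.
Proof.
move=> uY; set Q := 1%:M - Y *m Y^H.
have QH : Q^H = Q by rewrite adjmxB adjmx1 adjmxM adjmxK.
have QQ : Q *m Q = Q.
  rewrite {1}/Q mulmxBl mul1mx /Q mulmxBr mulmx1 mulmxA -(mulmxA Y) uY mulmx1.
  by rewrite subrr subr0.
rewrite !adjmxM QH adjmxK -!mulmxA (mulmxA Q) QQ -mulmxDr; congr (_ *m _).
by rewrite /Q mulmxBl mul1mx mulmxA addrC subrK.
Qed.

Lemma det_isometry_le m n k (Y : 'M[C]_(m, n)) (N : 'M[C]_(m, k)) :
  Y^H *m Y = 1%:M -> \det ((Y^H *m N)^H *m (Y^H *m N)) <= \det (N^H *m N).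
Proof. by move=> uY; rewrite -(isometry_split N uY) det_gramD_ge. Qed.

(** The index [c] is the last of the [k] largest entries. Raising all later entries to [p c] only
    increases the determinant and turns the diagonal into [p c * (1 + q)] with [q] supported on the
    first [k] indices. Sylvester's identity then moves the compression into [1 + r Y Y^H r], where
    [r ^ 2 = diag q], and [Y Y^H] is a projection. *)
Lemma det_diag_compress_le m k (Y : 'M[C]_(m, k)) (p : 'I_m -> C) (c : 'I_m) :
  Y^H *m Y = 1%:M -> (c.+1 = k)%N -> (forall i, 0 < p i) ->
  (forall i j : 'I_m, (i <= j)%N -> p j <= p i) ->
  \det (Y^H *m diag_mx (\row_i p i) *m Y) <= \prod_(i < m | (i < k)%N) p i.
Proof.
move=> uY ck p0 pdec.
have sqrt_diag (q : 'I_m -> C) : (forall i, 0 <= q i) ->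
    exists2 r : 'M[C]_m, r^H = r & diag_mx (\row_i q i) = r *m r.
  move=> q0; exists (diag_mx (\row_i sqrtC (q i))).
    rewrite adjmx_diag; congr diag_mx; apply/rowP => i; rewrite !mxE.
    by rewrite geC0_conj // sqrtC_ge0.
  rewrite mulmx_diag; congr diag_mx; apply/rowP => i.
  by rewrite !mxE -expr2 sqrtCK.
have gram (r : 'M[C]_m) : r^H = r -> (r *m Y)^H *m (r *m Y) = Y^H *m (r *m r) *m Y.
  by move=> rH; rewrite adjmxM rH !mulmxA.
have pk (i : 'I_m) : (k <= i)%N -> p i <= p c by move=> ki; apply: pdec; rewrite ltnW // ck.
have kp (i : 'I_m) : (i < k)%N -> p c <= p i by move=> ik; apply: pdec; rewrite -ltnS ck.
pose p' (i : 'I_m) := if (i < k)%N then p i else p c.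
have pp' i : 0 <= p' i - p i.
  by rewrite subr_ge0 /p'; case: ltnP => // /pk.
pose q (i : 'I_m) := if (i < k)%N then p i / p c - 1 else 0.
have q0 i : 0 <= q i.
  by rewrite /q; case: ltnP => // ik; rewrite subr_ge0 ler_pdivlMr // mul1r kp.
have [rp rpH rpE] := sqrt_diag p (fun i => ltW (p0 i)).
have [re reH reE] := sqrt_diag _ pp'.
have [r rH rE] := sqrt_diag q q0.
have le1 : \det (Y^H *m diag_mx (\row_i p i) *m Y) <=
    \det (Y^H *m diag_mx (\row_i p' i) *m Y).
  have -> : diag_mx (\row_i p' i) = diag_mx (\row_i p i) + diag_mx (\row_i (p' i - p i)).
    by rewrite -linearD; congr diag_mx; apply/rowP => i; rewrite !mxE addrC subrK.
  rewrite mulmxDr mulmxDl rpE reE -!gram //.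
  exact: det_gramD_ge.
apply: (le_trans le1).
have -> : Y^H *m diag_mx (\row_i p' i) *m Y = p c *: (1%:M + (r *m Y)^H *m (r *m Y)).
  have -> : diag_mx (\row_i p' i) = p c *: (1%:M + diag_mx (\row_i q i)).
    apply/matrixP => i j; rewrite !mxE; have [_|_] := eqVneq i j; last first.
      by rewrite !mulr0n addr0 mulr0.
    rewrite !mulr1n /p' /q; case: ifP => _; last by rewrite addr0 mulr1.
    by rewrite addrC subrK mulrC divfK // gt_eqF.
  by rewrite gram // -rE -scalemxAr -scalemxAl mulmxDr mulmxDl mulmx1 uY.
rewrite detZ.
have -> : \det (1%:M + (r *m Y)^H *m (r *m Y)) = \det (1%:M + (r *m Y) *m (r *m Y)^H).
  exact: det_1D_mulC.
have le2 : \det (1%:M + (r *m Y) *m (r *m Y)^H) <= \det (1%:M + diag_mx (\row_i q i)).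
  have eP : (col_mx 1%:M (Y^H *m r))^H *m col_mx 1%:M (Y^H *m r) =
      1%:M + (Y^H *m r)^H *m (Y^H *m r) by rewrite adjmx_col_mul adjmx1 mulmx1.
  have -> : 1%:M + r *m Y *m (r *m Y)^H = (col_mx 1%:M (Y^H *m r))^H *m col_mx 1%:M (Y^H *m r).
    by rewrite eP !adjmxM adjmxK rH !mulmxA.
  rewrite rE; have := isometry_split r uY; rewrite rH => <-.
  rewrite addrA -eP; exact: det_gramD_ge.
apply: (@le_trans _ _ (p c ^+ k * \det (1%:M + diag_mx (\row_i q i)))).
  by rewrite ler_wpM2l // exprn_ge0 // ltW.
rewrite det_diagD1.
have km : (k <= m)%N by rewrite -ck.
have -> : p c ^+ k = \prod_(i < m | (i < k)%N) p c.
  by rewrite -(big_ord_widen m (fun=> p c) km) prodr_const card_ord.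
rewrite [X in _ * X](bigID (fun i : 'I_m => (i < k)%N)) /= [X in _ * (_ * X)]big1 ?mulr1.
  rewrite -big_split /= le_eqVlt; apply/orP; left; apply/eqP.
  apply: eq_bigr => i ik.
  by rewrite mxE /q ik addrC subrK mulrC divfK // gt_eqF.
by move=> i /negbTE ik; rewrite mxE /q ik addr0.
Qed.

(** The squared modulus is a Gram determinant. [det_isometry_le] removes the compression on the
    left, and [det_diag_compress_le] handles the right one, through the isometry [W^H *m Y]. *)
Lemma norm_det_compress_le m k (Y : 'M[C]_(m, k)) (M W : 'M[C]_m) (p : 'I_m -> C) :
  Y^H *m Y = 1%:M -> W^H *m W = 1%:M -> (k <= m)%N ->
  M^H *m M = W *m diag_mx (\row_i p i) *m W^H ->
  (forall i, 0 < p i) -> (forall i j : 'I_m, (i <= j)%N -> p j <= p i) ->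
  `|\det (Y^H *m M *m Y)| ^+ 2 <= \prod_(i < m | (i < k)%N) p i.
Proof.
move=> uY uW km eM p0 pdec.
rewrite normCK mulrC -det_adjmx -det_mulmx -mulmxA.
apply: (le_trans (det_isometry_le (M *m Y) uY)).
have -> : (M *m Y)^H *m (M *m Y) =
    (W^H *m Y)^H *m diag_mx (\row_i p i) *m (W^H *m Y).
  by rewrite !adjmxM adjmxK !mulmxA -(mulmxA _ _ M) eM !mulmxA.
(* An empty compression has no last index to pass as [c]. *)
case: k Y uY km => [|k] Y uY km.
  by rewrite det_mx00 big_pred0.
apply: (@det_diag_compress_le _ _ _ _ (Ordinal km)) => //.
by rewrite adjmxM adjmxK mulmxA -(mulmxA _ W) (unitary_rev uW) mulmx1.
Qed.

End DetInequality.

(** * Convexity *)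

Section Subgradient.
Variables (R : realType) (D : nat).
Implicit Types (x y v w : 'rV[R]_D) (c : 'I_D -> R).

Definition convex_rV (H : 'rV[R]_D -> R) := forall x y (a : R), 0 <= a <= 1 ->
  H ((1 - a) *: x + a *: y) <= (1 - a) * H x + a * H y.

Definition pairing c v := \sum_i c i * v 0 i.

Let pairingD c v w : pairing c (v + w) = pairing c v + pairing c w.
Proof. by rewrite -big_split; apply: eq_bigr => i _; rewrite mxE mulrDr. Qed.

Let pairingZ c (a : R) v : pairing c (a *: v) = a * pairing c v.
Proof. by rewrite mulr_sumr; apply: eq_bigr => i _; rewrite mxE; ring. Qed.

(* Hahn-Banach, one coordinate at a time. *)
Lemma subgradient_aux (f : 'rV[R]_D -> R) (k : nat) :
  convex_rV f -> f 0 = 0 ->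
  exists c, forall v, (forall i : 'I_D, (k <= i)%N -> v 0 i = 0) -> pairing c v <= f v.
Proof.
move=> cf f0; elim: k => [|k [c IH]].
  exists (fun=> 0) => v v0.
  have -> : v = 0 by apply/rowP => i; rewrite v0 // mxE.
  by rewrite f0 /pairing big1 // => i _; rewrite mul0r.
have [kD|Dk] := ltnP k D; last first.
  exists c => v _; apply: IH => i ki.
  by have := leq_trans Dk ki; rewrite leqNgt ltn_ord.
pose K := Ordinal kD; pose e : 'rV[R]_D := delta_mx 0 K.
pose V v := forall i : 'I_D, (k <= i)%N -> v 0 i = 0.
(* [S] collects the lower bounds that vectors with negative [K]-th coordinate put on the new
   coefficient; positive ones give upper bounds. By convexity [sep] puts the former below the
   latter, so [sup S] serves. *)
pose S := [set z | exists w, exists r : R, [/\ V w, 0 < r & z = (pairing c w - f (w - r *: e)) / r]].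
have sep w r v s : V w -> V v -> 0 < r -> 0 < s ->
    (pairing c w - f (w - r *: e)) / r <= (f (v + s *: e) - pairing c v) / s.
  move=> Vw Vv r0 s0; have rs0 : 0 < r + s by lra.
  pose a := r / (r + s).
  have a01 : 0 <= a <= 1.
    apply/andP; split; first by apply: divr_ge0; exact: ltW.
    by rewrite ler_pdivrMr // mul1r lerDl ltW.
  have a1 : 1 - a = s / (r + s) by rewrite /a; field; rewrite gt_eqF.
  have comb : (1 - a) *: (w - r *: e) + a *: (v + s *: e) = (1 - a) *: w + a *: v.
    apply/rowP => i; rewrite !mxE a1 /a; field; rewrite gt_eqF //.
  have Vc : V ((1 - a) *: w + a *: v).
    by move=> i ki; rewrite !mxE Vw // Vv // !mulr0 addr0.
  have := le_trans (IH _ Vc) _; rewrite -comb => /(_ _ (cf _ _ _ a01)).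
  rewrite comb pairingD !pairingZ a1 /a.
  move: (pairing c w) (pairing c v) (f _) (f _) => A B F G h.
  have h' : s * A + r * B <= s * G + r * F.
    have e1 X Y : s / (r + s) * X + r / (r + s) * Y = (s * X + r * Y) / (r + s).
      by field; rewrite gt_eqF.
    have i0 : 0 < (r + s)^-1 by rewrite invr_gt0.
    by move: h; rewrite !e1 ler_pM2r.
  rewrite ler_pdivrMr // mulrAC ler_pdivlMr //; lra.
have V0 : V 0 by move=> i _; rewrite mxE.
have S0 : S !=set0 by exists ((pairing c 0 - f (0 - 1 *: e)) / 1), 0, 1; split.
have Sub z : S z -> z <= sup S.
  move=> Sz; apply: ub_le_sup => //.
  exists ((f (0 + 1 *: e) - pairing c 0) / 1) => _ [w [r [Vw r0 ->]]].
  exact: sep.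
pose c' i := if i == K then sup S else c i.
exists c' => v Vv.
pose v' := v - v 0 K *: e.
have Vv' : V v'.
  move=> i ki; rewrite !mxE eqxx /=; have [->|iK] := eqVneq i K.
    by rewrite mulr1 subrr.
  rewrite mulr0 subr0 Vv // ltn_neqAle ki andbT eq_sym.
  by apply: contra iK => /eqP ik; apply/eqP/val_inj.
have vE : v = v' + v 0 K *: e by rewrite subrK.
have -> : pairing c' v = pairing c v' + sup S * v 0 K.
  have -> : pairing c v' = \sum_(i | i != K) c i * v 0 i.
    rewrite /pairing (bigD1 K) //= Vv' // mulr0 add0r; apply: eq_bigr => i iK.
    by rewrite !mxE eqxx /= (negbTE iK) mulr0 subr0.
  rewrite /pairing (bigD1 K) //= /c' eqxx addrC; congr (_ + _).
  by apply: eq_bigr => i /negbTE ->.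
have [vK|vK|vK] := ltgtP (v 0 K) 0.
- have : S ((pairing c v' - f (v' - (- v 0 K) *: e)) / - v 0 K).
    by exists v', (- v 0 K); split => //; rewrite oppr_gt0.
  move=> /Sub; rewrite scaleNr opprK -vE ler_pdivrMr ?oppr_gt0 //; lra.
- have : sup S <= (f (v' + v 0 K *: e) - pairing c v') / v 0 K.
    by apply: ge_sup => // _ [w [r [Vw r0 ->]]]; exact: sep.
  rewrite -vE ler_pdivlMr //; lra.
- by rewrite vK mulr0 addr0 [in f v]vE vK scale0r addr0 IH.
Qed.

Lemma subgradient (H : 'rV[R]_D -> R) x : convex_rV H ->
  exists c, forall y, H x + \sum_i c i * (y 0 i - x 0 i) <= H y.
Proof.
move=> cH; pose f v := H (x + v) - H x.
have cf : convex_rV f.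
  move=> v w a a01; rewrite /f.
  have -> : x + ((1 - a) *: v + a *: w) = (1 - a) *: (x + v) + a *: (x + w).
    by apply/rowP => i; rewrite !mxE; ring.
  have := cH (x + v) (x + w) a a01; lra.
have f0 : f 0 = 0 by rewrite /f addr0 subrr.
have [c hc] := subgradient_aux D cf f0.
exists c => y; have := hc (y - x); rewrite /f subrKC => h.
have {}h : pairing c (y - x) <= H y - H x.
  by apply: h => i; rewrite leqNgt ltn_ord.
suff -> : \sum_i c i * (y 0 i - x 0 i) = pairing c (y - x) by lra.
by apply: eq_bigr => i _; rewrite !mxE.
Qed.

Lemma sorting_perm c :
  exists s : {perm 'I_D}, forall i j : 'I_D, (i <= j)%N -> c (s j) <= c (s i).
Proof.
pose t := [tuple c i | i < D].
pose r : rel R := fun a b => b <= a.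
have rtot : total r by move=> a b; rewrite /r le_total.
have rtr : transitive r by move=> a b d ab bd; exact: le_trans bd ab.
have st : size (sort r t) == D by rewrite size_sort size_tuple.
have : perm_eq (Tuple st) t by rewrite perm_sort.
move=> /tuple_permP[s es]; exists s => i j ij.
have tE k : nth 0 (sort r t) (k : 'I_D) = c (s k).
  have -> : sort r t = Tuple st by [].
  by rewrite es -tnth_nth tnth_mktuple /t tnth_mktuple.
rewrite -!tE.
have refl : reflexive r by move=> a; rewrite /r lexx.
apply: (sorted_leq_nth rtr refl 0 (sort_sorted rtot _)) => //.
- by rewrite inE (eqP st).
- by rewrite inE (eqP st).
Qed.

End Subgradient.

Lemma abel_sum (R : pzRingType) (c z : nat -> R) (n : nat) :
  \sum_(i < n.+1) c i * z i =
  \sum_(k < n) (c k - c k.+1) * (\sum_(i < k.+1) z i) + c n * \sum_(i < n.+1) z i.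
Proof.
elim: n => [|n IH]; first by rewrite !big_ord1 big_ord0 add0r.
rewrite big_ord_recr /= IH [in RHS]big_ord_recr /= -!addrA; congr (_ + _).
rewrite [in RHS](big_ord_recr n.+1) /= mulrDr addrA mulrBl.
by rewrite subrK.
Qed.

(** * Symmetric gauge functions *)

Section Gauge.
Variables (R : realType) (D : nat) (rho : 'rV[R]_D -> R).
Hypothesis rho_gauge : sym_gauge rho.
Implicit Types (x y : 'rV[R]_D).

Let rho_gt0 x : x != 0 -> 0 < rho x. Proof. by case: rho_gauge => + _ _ _ _; apply. Qed.
Let rhoZ (a : R) x : rho (a *: x) = `|a| * rho x. Proof. by case: rho_gauge. Qed.
Let rhoD x y : rho (x + y) <= rho x + rho y. Proof. by case: rho_gauge. Qed.
Let rho_perm (s : {perm 'I_D}) x : rho (\row_i x 0 (s i)) = rho x.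
Proof. by case: rho_gauge. Qed.
Let rho_abs x : rho (\row_i `|x 0 i|) = rho x. Proof. by case: rho_gauge. Qed.

(* Lowering one coordinate from [y_j] to [x_j] is a convex combination of [y]
   and of [y] with the sign of its [j]-th coordinate flipped. *)
Let rho_mono1 (j : 'I_D) x y : (forall i, i != j -> x 0 i = y 0 i) ->
  0 <= x 0 j <= y 0 j -> rho x <= rho y.
Proof.
move=> xy /andP[x0 xyj].
have [yj0|yj0] := eqVneq (y 0 j) 0.
  have -> // : x = y.
  by apply/rowP => i; have [->|/xy//] := eqVneq i j; apply/eqP; rewrite yj0 eq_le -{1}yj0 xyj.
have yj : 0 < y 0 j by rewrite lt0r yj0 (le_trans x0).
pose y' : 'rV[R]_D := \row_i if i == j then - y 0 i else y 0 i.
pose a := (1 + x 0 j / y 0 j) / 2.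
have q01 : 0 <= x 0 j / y 0 j <= 1.
  apply/andP; split; first by apply: divr_ge0 => //; exact: ltW.
  by rewrite ler_pdivrMr // mul1r.
have ex : x = a *: y + (1 - a) *: y'.
  apply/rowP => i; rewrite !mxE; have [->|/xy ->] := eqVneq i j; last ring.
  by rewrite /a; field; rewrite gt_eqF.
have ry' : rho y' = rho y.
  rewrite -rho_abs -[RHS]rho_abs; congr rho; apply/rowP => i; rewrite !mxE.
  by case: ifP; rewrite ?normrN.
rewrite ex; apply: le_trans (rhoD _ _) _.
rewrite !rhoZ ry' !ger0_norm ?subr_ge0; rewrite /a; lra.
Qed.

Lemma gauge_mono x y : (forall i, 0 <= x 0 i <= y 0 i) -> rho x <= rho y.
Proof.
move=> xy.
pose z (k : nat) : 'rV[R]_D := \row_i if (i < k)%N then x 0 i else y 0 i.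
have zx : z D = x by apply/rowP => i; rewrite mxE ltn_ord.
have zy : z 0%N = y by apply/rowP => i; rewrite mxE.
suff zz k : rho (z k) <= rho y by rewrite -zx.
elim: k => [|k IH]; first by rewrite zy.
have [kD|Dk] := ltnP k D; last first.
  rewrite (_ : z k.+1 = z k) //; apply/rowP => i; rewrite !mxE.
  by rewrite !(leq_trans (ltn_ord i)) // leqW.
apply: le_trans IH; apply: (@rho_mono1 (Ordinal kD)).
  move=> i ik; rewrite !mxE ltnS leq_eqVlt.
  by rewrite (negbTE (_ : i != k :> nat)).
by rewrite !mxE /= ltnSn ltnn.
Qed.

Section Compose.
Variable f : R -> R.

Definition gauge_exp x := rho (\row_i f (expR (x 0 i))).

Lemma gauge_exp_perm (s : {perm 'I_D}) x :
  gauge_exp (\row_i x 0 (s i)) = gauge_exp x.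
Proof.
rewrite /gauge_exp -[RHS](rho_perm s); congr rho.
by apply/rowP => i; rewrite !mxE.
Qed.

Lemma gauge_exp_convex : (forall x : R, 0 < x -> 0 <= f x) ->
  (forall (x y a : R), 0 <= a <= 1 ->
     f (expR ((1 - a) * x + a * y)) <= (1 - a) * f (expR x) + a * f (expR y)) ->
  convex_rV gauge_exp.
Proof.
move=> f0 cf x y a a01; rewrite /gauge_exp.
apply: le_trans (gauge_mono (y := (1 - a) *: (\row_i f (expR (x 0 i))) + a *: \row_i f (expR (y 0 i))) _) _.
  by move=> i; rewrite !mxE f0 ?expR_gt0 //= cf.
apply: le_trans (rhoD _ _) _; rewrite !rhoZ !ger0_norm //; lra.
Qed.

Hypothesis D0 : (0 < D)%N.
Hypothesis f_gt0 : forall x : R, 0 < x -> 0 < f x.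

Let fe_gt0 (x : R) : 0 < f (expR x). Proof. exact/f_gt0/expR_gt0. Qed.

Lemma gauge_exp_gt0 x : 0 < gauge_exp x.
Proof.
apply: rho_gt0; apply/eqP => /rowP/(_ (Ordinal D0)); rewrite !mxE => /eqP.
by rewrite gt_eqF.
Qed.

(* Hoelder's inequality for gauges: weighted AM-GM after normalisation. *)
Lemma ln_gauge_exp_convex :
  (forall (x y a : R), 0 <= a <= 1 ->
     ln (f (expR ((1 - a) * x + a * y))) <=
     (1 - a) * ln (f (expR x)) + a * ln (f (expR y))) ->
  convex_rV (fun x => ln (gauge_exp x)).
Proof.
move=> cf x y a a01.
pose X := gauge_exp x; pose Y := gauge_exp y.
have X0 : 0 < X by exact: gauge_exp_gt0.
have Y0 : 0 < Y by exact: gauge_exp_gt0.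
pose G := expR ((1 - a) * ln X + a * ln Y).
have G0 : 0 < G by exact: expR_gt0.
suff : gauge_exp ((1 - a) *: x + a *: y) <= G.
  by rewrite -ler_ln ?posrE ?gauge_exp_gt0 // expRK.
pose z : 'rV[R]_D := G *: ((1 - a) *: (X^-1 *: \row_i f (expR (x 0 i))) +
                           a *: (Y^-1 *: \row_i f (expR (y 0 i)))).
apply: (@le_trans _ _ (rho z)).
  apply: gauge_mono => i; rewrite !mxE ltW //=.
  set p := f (expR (x 0 i)); set q := f (expR (y 0 i)).
  have p0 : 0 < p by exact: fe_gt0.
  have q0 : 0 < q by exact: fe_gt0.
  have h := cf (x 0 i) (y 0 i) a a01.
  rewrite -[leLHS]lnK ?posrE ?fe_gt0 //.
  apply: (@le_trans _ _ (expR ((1 - a) * ln p + a * ln q))); first by rewrite ler_expR.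
  have -> : (1 - a) * ln p + a * ln q = ((1 - a) * ln X + a * ln Y) +
      ((1 - a) * ln (X^-1 * p) + a * ln (Y^-1 * q)).
    by rewrite !lnM ?posrE ?invr_gt0 // !lnV ?posrE //; ring.
  rewrite expRD -/G ler_pM2l //.
  have amgm (u v : R) : 0 < u -> 0 < v ->
      expR ((1 - a) * ln u + a * ln v) <= (1 - a) * u + a * v.
    move=> u0 v0; pose m := (1 - a) * ln u + a * ln v.
    (* The tangent of the exponential at [m]. Averaged over [u] and [v], its first-order terms
       cancel because [m] is the weighted mean of the logarithms. *)
    have tang w : 0 < w -> expR m * (1 + (ln w - m)) <= w.
      move=> w0; have ew : w = expR m * expR (ln w - m) by rewrite -expRD subrKC lnK.
      by rewrite [leRHS]ew ler_pM2l ?expR_gt0 // expR_ge1Dx.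
    have -> : expR ((1 - a) * ln u + a * ln v) =
        (1 - a) * (expR m * (1 + (ln u - m))) + a * (expR m * (1 + (ln v - m))).
      have -> : (1 - a) * (expR m * (1 + (ln u - m))) + a * (expR m * (1 + (ln v - m)))
          = expR m * (1 + ((1 - a) * ln u + a * ln v) - m) by ring.
      by rewrite -/m addrK mulr1.
    by apply: lerD; rewrite ler_wpM2l ?tang //; lra.
  by apply: amgm; rewrite mulr_gt0 // invr_gt0.
rewrite /z rhoZ (gtr0_norm G0) -[leRHS]mulr1 ler_pM2l //.
apply: le_trans (rhoD _ _) _.
rewrite !rhoZ -/(gauge_exp x) -/(gauge_exp y) -/X -/Y.
rewrite !(@gtr0_norm _ _^-1) ?invr_gt0 // !mulVf ?gt_eqF //.
rewrite !mulr1 !ger0_norm; lra.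
Qed.

End Compose.
End Gauge.

(* The integral is a difference of two suprema over simple functions, so its
   monotonicity does not depend on measurability. *)
Lemma le_integral_unmeasurable d (T : measurableType d) (R : realType)
    (mu : {measure set T -> \bar R}) (f g : T -> \bar R) :
  (forall t, f t <= g t)%E -> (\int[mu]_t f t <= \int[mu]_t g t)%E.
Proof.
move=> fg; rewrite /integral !patch_setT.
have fg' : {in setT, forall t, (f t <= g t)%E} by move=> t _.
apply: leeB; apply: le_ereal_sup => _ [h hf <-]; exists h => // t;
  apply: le_trans (hf t) _.
- by apply: (funepos_le fg'); rewrite inE.
- by apply: (funeneg_le fg'); rewrite inE.
Qed.

Section IntegrableSum.
Context d (T : measurableType d) (R : realType) (mu : {measure set T -> \bar R}).
Variables (K : Type) (F : K -> T -> R).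
Hypothesis intF : forall k, mu.-integrable setT (fun t => (F k t)%:E).

Lemma integrable_seq_sum (r : seq K) :
  mu.-integrable setT (fun t => (\sum_(k <- r) F k t)%:E).
Proof.
elim: r => [|k r IH].
  apply: eq_integrable (integrable0 mu setT) => // t _.
  by rewrite big_nil.
apply: eq_integrable (integrableD measurableT (intF k) IH) => // t _.
by rewrite big_cons.
Qed.

Lemma Rintegral_seq_sum (r : seq K) :
  \int[mu]_t (\sum_(k <- r) F k t) = \sum_(k <- r) \int[mu]_t F k t.
Proof.
elim: r => [|k r IH].
  rewrite big_nil -[RHS](Rintegral_set0 mu (fun=> 0)) /Rintegral integral_set0.
  by congr fine; apply: integral0_eq => t _; rewrite big_nil.
rewrite big_cons -IH -(RintegralD measurableT (intF k) (integrable_seq_sum r)).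
by apply: eq_Rintegral => t _; rewrite big_cons.
Qed.

End IntegrableSum.

(** * From averaged majorization to convex symmetric functions *)

Section Majorization.
Variables (R : realType) (m : nat).
Notation D := m.+1.
Notation mu := (@lebesgue_measure R).
Variables (H : 'rV[R]_D -> R) (l : 'rV[R]_D) (y : R -> 'rV[R]_D).
Hypothesis H_convex : convex_rV H.
Hypothesis H_perm : forall (s : {perm 'I_D}) (x : 'rV[R]_D), H (\row_i x 0 (s i)) = H x.
Hypothesis total : forall t, \sum_i y t 0 i = \sum_i l 0 i.
Hypothesis partial : forall (s : {perm 'I_D}) (k : nat) (e : R), (k < D)%N -> 0 < e ->
  exists b : R -> R, [/\ continuous b, exists M, forall t, `|b t| <= M,
    forall t, b t <= \sum_(i < D | (i < k)%N) y t 0 i &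
    \sum_(i < D | (i < k)%N) l 0 (s i) - e <= \int[mu]_t (b t * beta0 t)].

(** Abel summation turns the subgradient inequality into partial sums weighted by differences of
    sorted coefficients, which are nonnegative. The full sum carries a coefficient of unknown sign,
    but [total] makes it vanish. *)
Lemma majorization_integral :
  ((H l)%:E <= \int[mu]_(t in setT) (H (y t) * beta0 t)%:E)%E.
Proof.
have [c0 hc0] := subgradient l H_convex.
have [s cs] := sorting_perm c0.
pose c (i : nat) := c0 (s (inord i)).
pose ls : 'rV[R]_D := \row_i l 0 (s i).
(* By symmetry of [H], the rearrangement that sorts the subgradient is applied to [l] while [z]
   stays as it is. *)
have hc (z : 'rV[R]_D) : H l + \sum_(i < D) c i * (z 0 i - ls 0 i) <= H z.
  have := hc0 (\row_i z 0 ((s^-1)%g i)); rewrite H_perm; apply: le_trans.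
  rewrite lerD2l le_eqVlt; apply/orP; left; apply/eqP.
  rewrite [RHS](reindex_inj (@perm_inj _ s)) /=.
  by apply: eq_bigr => i _; rewrite /c inord_val !mxE permK.
pose dk (k : nat) := c k - c k.+1.
have dk0 (k : 'I_m) : 0 <= dk k.
  rewrite subr_ge0; apply: cs; have km := ltn_ord k.
  by rewrite !inordK ?ltnS ?(ltnW km) // leqnSn.
have lsum : \sum_i ls 0 i = \sum_i l 0 i.
  by rewrite [RHS](reindex_inj (@perm_inj _ s)); apply: eq_bigr => i _; rewrite mxE.
pose S (z : 'rV[R]_D) (k : nat) := \sum_(i < D | (i < k)%N) z 0 i.
have SE (z : 'rV[R]_D) k : (k < D)%N -> \sum_(i < k) z 0 (inord i) = S z k.
  move=> kD; rewrite /S (big_ord_widen D (fun i => z 0 (inord i))) //; last exact: ltnW.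
  by apply: eq_bigr => i _; rewrite inord_val.
have abel t : \sum_(i < D) c i * (y t 0 i - ls 0 i) =
    \sum_(k < m) dk k * (S (y t) k.+1 - S ls k.+1).
  have := abel_sum c (fun i => y t 0 (inord i) - ls 0 (inord i)) m.
  have -> : \sum_(i < D) (y t 0 (inord i) - ls 0 (inord i)) = 0.
    rewrite sumrB -[RHS](subrr (\sum_i l 0 i)) -{1}(total t) -lsum.
    by congr (_ - _); apply: eq_bigr => i _; rewrite inord_val.
  rewrite mulr0 addr0 => eab.
  transitivity (\sum_(i < D) c i * (y t 0 (inord i) - ls 0 (inord i))).
    by apply: eq_bigr => i _; rewrite inord_val.
  rewrite eab; apply: eq_bigr => k _; rewrite sumrB !SE //; exact: ltn_ord.
apply/lee_addgt0Pr => e e0.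
pose W := \sum_(k < m) dk k.
have W0 : 0 <= W by apply: sumr_ge0.
(* The errors [h], weighted by [dk], add up to [W * h <= e]; the [1] covers [W = 0]. *)
pose h := e / (W + 1).
have h0 : 0 < h by rewrite divr_gt0 // ltr_wpDl.
have [b hb] : exists b : 'I_m -> R -> R, forall k, [/\ continuous (b k), exists M, forall t, `|b k t| <= M,
    forall t, b k t <= S (y t) k.+1 &
    S ls k.+1 - h <= \int[mu]_t (b k t * beta0 t)].
  have ex (k : 'I_m) := @partial s k.+1 h (ltn_ord k) h0.
  exists (fun k => projT1 (cid (ex k))) => k.
  case: (cid (ex k)) => bk /= [? ? ? le]; split => //.
  by apply: le_trans le; rewrite lerD2r /S; apply: ler_sum => i _; rewrite mxE.
pose g t := H l + \sum_(k < m) dk k * (b k t - S ls k.+1).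
have gH t : g t <= H (y t).
  apply: le_trans (hc (y t)); rewrite lerD2l abel; apply: ler_sum => k _.
  by rewrite ler_wpM2l // lerD2r; case: (hb k).
have intb k : mu.-integrable setT (fun t => (b k t * beta0 t)%:E).
  by case: (hb k) => cb [M bM] _ _; exact: integrable_beta0M bM.
have intc (a : R) : mu.-integrable setT (fun t => (a * beta0 t)%:E).
  by apply: (@integrable_beta0M _ (fun=> a) `|a|); [exact: cst_continuous|].
pose a := H l - \sum_(k < m) dk k * S ls k.+1.
have gE t : g t * beta0 t = a * beta0 t + \sum_(k < m) dk k * (b k t * beta0 t).
  rewrite /g /a; under eq_bigr do rewrite mulrBr.
  rewrite sumrB addrA addrAC mulrDl; congr (_ + _).
  by rewrite mulr_suml; apply: eq_bigr => k _; rewrite mulrA.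
have intdb (k : 'I_m) : mu.-integrable setT (fun t => (dk k * (b k t * beta0 t))%:E).
  by apply: eq_integrable (integrableZl measurableT (dk k) (intb k)).
have ints := integrable_seq_sum intdb (index_enum 'I_m).
have intg : mu.-integrable setT (fun t => (g t * beta0 t)%:E).
  apply: eq_integrable (integrableD measurableT (intc a) ints) => // t _.
  by rewrite gE EFinD.
have Ig : H l - e <= \int[mu]_t (g t * beta0 t).
  under eq_Rintegral do rewrite gE.
  rewrite (RintegralD measurableT (intc a) ints) (Rintegral_seq_sum intdb).
  rewrite Rintegral_beta0M.
  have : \sum_(k < m) dk k * (S ls k.+1 - h) <= \sum_(k < m) \int[mu]_t (dk k * (b k t * beta0 t)).
    apply: ler_sum => k _; rewrite (RintegralZl (dk k) measurableT (intb k)) ler_wpM2l //.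
    by case: (hb k).
  under eq_bigr do rewrite mulrBr.
  rewrite sumrB -mulr_suml -/W.
  have : W * h <= e.
    have W1 : W / (W + 1) <= 1 by rewrite ler_pdivrMr ?ltr_wpDl // mul1r lerDl.
    by rewrite /h mulrCA ler_piMr // ltW.
  rewrite /a; lra.
have : (\int[mu]_t (g t * beta0 t)%:E <= \int[mu]_t (H (y t) * beta0 t)%:E)%E.
  apply: le_integral_unmeasurable => t; rewrite lee_fin ler_wpM2r ?beta0_ge0 //.
move=> /(fun x => leeD2r e%:E x); apply: le_trans.
rewrite -[X in (_ <= X + _)%E]fineK; last exact: integrable_fin_num.
by rewrite -EFinD lee_fin -lerBlDr.
Qed.

End Majorization.

(** * Complex exponential sums *)

Local Open Scope complex_scope.

Section ComplexExpSum.
Variable R : realType.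
Local Notation C := R[i].
Implicit Types (w : R * (R * R)) (s : seq (R * (R * R))) (x t : R).

Definition eterm w x t : C := eterm_re w x t +i* eterm_im w x t.
Definition esum s x t : C := \sum_(w <- s) eterm w x t.

Lemma esumE s x t : esum s x t = esum_re s x t +i* esum_im s x t.
Proof.
rewrite /esum /esum_re /esum_im; elim: s => [|w s IH]; first by rewrite !big_nil.
by rewrite !big_cons IH.
Qed.

Definition der_exp w : R * (R * R) := (w.1, (w.1 * w.2.1, w.1 * w.2.2)).

Definition mul_exp w1 w2 : R * (R * R) :=
  (w1.1 + w2.1, (w1.2.1 * w2.2.1 - w1.2.2 * w2.2.2, w1.2.1 * w2.2.2 + w1.2.2 * w2.2.1)).

Lemma eterm_mul w1 w2 x t : eterm (mul_exp w1 w2) x t = eterm w1 x t * eterm w2 x t.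
Proof.
rewrite /eterm /eterm_re /eterm_im /mul_exp /= !mulrDl expRD cosD sinD.
by apply/eqP; rewrite eq_complex /=; apply/andP; split; apply/eqP; ring.
Qed.

Lemma eterm00 w : eterm w 0 0 = w.2.1 +i* w.2.2.
Proof.
rewrite /eterm /eterm_re /eterm_im !mulr0 expR0 cos0 sin0 !mul1r !mulr0 !mulr1.
by rewrite subr0 add0r.
Qed.

Lemma eterm_der_mul w1 w2 :
  eterm (der_exp (mul_exp w1 w2)) 0 0 =
  eterm (der_exp w1) 0 0 * eterm w2 0 0 + eterm w1 0 0 * eterm (der_exp w2) 0 0.
Proof.
rewrite !eterm00 /der_exp /mul_exp /=.
by apply/eqP; rewrite eq_complex /=; apply/andP; split; apply/eqP; ring.
Qed.

(* [d] is the derivative at [0] of the exponential sum [phi]. *)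
Definition is_esum (phi : R -> R -> C) (d : C) := exists s,
  (forall x t, phi x t = esum s x t) /\ d = esum (esum_der s) 0 0.

Lemma eq_is_esum (phi psi : R -> R -> C) d : (forall x t, phi x t = psi x t) ->
  is_esum phi d -> is_esum psi d.
Proof. by move=> e [s [h1 h2]]; exists s; split => // x t; rewrite -e. Qed.

Lemma is_esum_cst (c : C) : is_esum (fun _ _ => c) 0.
Proof.
exists [:: (0, (complex.Re c, complex.Im c))]; split=> [x t|].
  rewrite /esum big_seq1 /eterm /eterm_re /eterm_im /= !mul0r expR0 cos0 sin0.
  by rewrite !mul1r !mulr0 !mulr1 subr0 add0r; case: c.
by rewrite /esum big_seq1 eterm00 /= !mul0r.
Qed.

Lemma is_esum_exp (m : R) (phi : R -> R -> C) :
  (forall x t, phi x t = (expR (m * x))%:C * (cos (m * t) +i* sin (m * t))) ->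
  is_esum phi m%:C.
Proof.
move=> e; exists [:: (m, (1, 0))]; split=> [x t|].
  rewrite e /esum big_seq1 /eterm /eterm_re /eterm_im /= !mul1r !mul0r subr0 addr0.
  by apply/eqP; rewrite eq_complex /= !mul0r subr0 addr0 !eqxx.
by rewrite /esum big_seq1 eterm00 /= mulr0 mulr1.
Qed.

Lemma is_esumD phi psi d e : is_esum phi d -> is_esum psi e ->
  is_esum (fun x t => phi x t + psi x t) (d + e).
Proof.
move=> [s [h1 ->]] [r [h2 ->]]; exists (s ++ r); split=> [x t|].
  by rewrite h1 h2 /esum big_cat.
by rewrite /esum_der map_cat /esum big_cat.
Qed.

Lemma is_esumM phi psi d e : is_esum phi d -> is_esum psi e ->
  is_esum (fun x t => phi x t * psi x t) (d * psi 0 0 + phi 0 0 * e).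
Proof.
move=> [s [h1 ->]] [r [h2 ->]]; exists [seq mul_exp a b | a <- s, b <- r]; split.
  move=> x t; rewrite h1 h2 /esum big_allpairs_dep mulr_suml; apply: eq_bigr => a _.
  by rewrite mulr_sumr; apply: eq_bigr => b _; rewrite eterm_mul.
rewrite h1 h2 /esum /esum_der !big_map big_allpairs_dep !mulr_suml -big_split /=.
apply: eq_bigr => a _; rewrite !mulr_sumr -big_split /=.
by apply: eq_bigr => b _; rewrite [RHS]eterm_der_mul.
Qed.

Lemma is_esum_sum (K : Type) (r : seq K) (phi : K -> R -> R -> C) d :
  (forall k, is_esum (phi k) (d k)) ->
  is_esum (fun x t => \sum_(k <- r) phi k x t) (\sum_(k <- r) d k).
Proof.
move=> h; elim: r => [|k r IH].
  by rewrite big_nil; apply: eq_is_esum (is_esum_cst 0) => x t; rewrite big_nil.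
rewrite big_cons; apply: eq_is_esum (is_esumD (h k) IH) => x t.
by rewrite big_cons.
Qed.

(** The derivative may stay unspecified: in [is_esum_det] this product is multiplied by an
    off-diagonal entry whose value and derivative at [0] both vanish. *)
Lemma is_esum_prod_ex (K : Type) (r : seq K) (P : pred K) (phi : K -> R -> R -> C) :
  (forall k, exists d, is_esum (phi k) d) ->
  exists d, is_esum (fun x t => \prod_(k <- r | P k) phi k x t) d.
Proof.
move=> h; elim: r => [|k r [d IH]].
  by exists 0; apply: eq_is_esum (is_esum_cst 1) => x t; rewrite big_nil.
have [Pk|Pk] := boolP (P k); last first.
  by exists d; apply: eq_is_esum IH => x t; rewrite big_cons (negbTE Pk).
have [e he] := h k; exists (e * (\prod_(k <- r | P k) phi k 0 0) + phi k 0 0 * d).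
by apply: eq_is_esum (is_esumM he IH) => x t; rewrite big_cons Pk.
Qed.

Lemma is_esum_prod1 (K : Type) (r : seq K) (phi : K -> R -> R -> C) d :
  (forall k, is_esum (phi k) (d k)) -> (forall k, phi k 0 0 = 1) ->
  is_esum (fun x t => \prod_(k <- r) phi k x t) (\sum_(k <- r) d k).
Proof.
move=> h h1; elim: r => [|k r IH].
  by rewrite big_nil; apply: eq_is_esum (is_esum_cst 1) => x t; rewrite big_nil.
have := is_esumM (h k) IH; rewrite h1 mul1r big1 // mulr1 big_cons.
by apply: eq_is_esum => x t; rewrite big_cons.
Qed.

Definition is_esum_mx m n (F : R -> R -> 'M[C]_(m, n)) (D : 'M[C]_(m, n)) :=
  forall i j, is_esum (fun x t => F x t i j) (D i j).

Lemma is_esum_mx_cst m n (A : 'M[C]_(m, n)) : is_esum_mx (fun _ _ => A) 0.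
Proof. by move=> i j; rewrite mxE; exact: is_esum_cst. Qed.

Lemma is_esum_mxM m n p (F : R -> R -> 'M[C]_(m, n)) (G : R -> R -> 'M[C]_(n, p)) D E :
  is_esum_mx F D -> is_esum_mx G E ->
  is_esum_mx (fun x t => F x t *m G x t) (D *m G 0 0 + F 0 0 *m E).
Proof.
move=> hF hG i j; rewrite !mxE -big_split /=.
have := is_esum_sum (index_enum 'I_n) (fun k => is_esumM (hF i k) (hG k j)).
by apply: eq_is_esum => x t; rewrite mxE.
Qed.

(* Expanding the determinant at a point where the value is [1] and the
   derivative is diagonal, only the identity permutation contributes. *)
Lemma is_esum_det n (F : R -> R -> 'M[C]_n) (d : 'rV[C]_n) :
  is_esum_mx F (diag_mx d) -> F 0 0 = 1%:M ->
  is_esum (fun x t => \det (F x t)) (\sum_i d 0 i).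
Proof.
move=> hF F1.
pose dd (s : {perm 'I_n}) : C := if s == 1%g then \sum_i d 0 i else 0.
have -> : \sum_i d 0 i = \sum_s dd s.
  rewrite (bigD1 (1%g : {perm 'I_n})) //= {1}/dd eqxx [X in _ = _ + X]big1 ?addr0 // => s /negbTE s1.
  by rewrite /dd s1.
suff h (s : {perm 'I_n}) : is_esum (fun x t => (-1) ^+ s * \prod_i F x t i (s i)) (dd s).
  exact: (is_esum_sum (index_enum {perm 'I_n}) h).
rewrite /dd; have [->|s1] := eqVneq s 1%g.
  rewrite odd_perm1 expr0.
  have := is_esum_prod1 (index_enum 'I_n) (phi := fun i x t => F x t i i) (d := fun i => d 0 i).
  case.
  - by move=> i; have := hF i i; rewrite mxE eqxx mulr1n.
  - by move=> i; rewrite F1 mxE eqxx.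
  move=> r hr; exists r; rewrite -hr.2; split=> // x t.
  by rewrite mul1r -hr.1; apply: eq_bigr => i _; rewrite perm1.
have [i si] : exists i, s i != i.
  apply/existsP; rewrite -negb_forall; apply: contra s1 => /forallP h.
  by apply/eqP/permP => i; rewrite perm1; apply/eqP.
have [e he] := is_esum_prod_ex (index_enum 'I_n) (fun j => j != i)
  (phi := fun j x t => F x t j (s j)) (fun j => ex_intro _ _ (hF j (s j))).
have h0 := hF i (s i).
have := is_esumM (is_esum_cst ((-1) ^+ s)) (is_esumM h0 he).
rewrite F1 !mxE eq_sym (negbTE si) /= mulr0n !mul0r addr0 mulr0 addr0.
by apply: eq_is_esum => x t; rewrite [in RHS](bigD1 i).
Qed.

End ComplexExpSum.

(** * Products of complex powers *)

Section MatrixPowers.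
Variable R : realType.
Local Notation C := R[i].
Notation mu := (@lebesgue_measure R).
Local Notation "A ^H" := (adjmx A) (at level 8, format "A ^H").

Lemma sqr_normC_ReIm (z : C) :
  `|z| ^+ 2 = (complex.Re z ^+ 2 + complex.Im z ^+ 2)%:C.
Proof.
rewrite normCK; case: z => a b; apply/eqP; rewrite eq_complex /=.
by apply/andP; split; apply/eqP; ring.
Qed.

Lemma cexp_lnE (x t c : R) : cexp ((x +i* t) * c%:C) =
  (expR (c * x))%:C * (cos (c * t) +i* sin (c * t)).
Proof. by rewrite /cexp; simpc; rewrite (mulrC x) (mulrC t). Qed.

Lemma norm_cexp_ln (x t c : R) : `|cexp ((x +i* t) * c%:C)| ^+ 2 = (expR (2 * (c * x)))%:C.
Proof.
rewrite cexp_lnE normrM exprMn !sqr_normC_ReIm /= cos2Dsin2 mulr1.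
by rewrite expr0n addr0 -expRM_natl.
Qed.

Variable D : nat.

Definition cpow (W : 'M[C]_D) (lam : 'I_D -> R) (x t : R) : 'M[C]_D :=
  W *m diag_mx (\row_a cexp ((x +i* t) * (ln (lam a))%:C)) *m W^H.

Definition clog (W : 'M[C]_D) (lam : 'I_D -> R) : 'M[C]_D :=
  W *m diag_mx (\row_a (ln (lam a))%:C) *m W^H.

Definition cprod n (W : 'I_n -> 'M[C]_D) (lam : 'I_n -> 'I_D -> R) (x t : R) : 'M[C]_D :=
  \big[mulmx/1%:M]_(i < n) cpow (W i) (lam i) x t.

Lemma cpow_esum W lam : is_esum_mx (cpow W lam) (clog W lam).
Proof.
have hd : is_esum_mx (fun x t : R => diag_mx (\row_a cexp ((x +i* t) * (ln (lam a))%:C)))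
    (diag_mx (\row_a (ln (lam a))%:C)).
  move=> i j; rewrite mxE; have [<-|ij] := eqVneq i j; last first.
    rewrite mulr0n; apply: eq_is_esum (is_esum_cst 0) => x t.
    by rewrite mxE (negbTE ij) mulr0n.
  rewrite mulr1n mxE; apply: is_esum_exp => x t.
  by rewrite mxE eqxx mulr1n mxE cexp_lnE.
have := is_esum_mxM (is_esum_mxM (is_esum_mx_cst W) hd) (is_esum_mx_cst W^H).
by rewrite mul0mx add0r mulmx0 addr0.
Qed.

Lemma cpow00 W lam : W^H *m W = 1%:M -> cpow W lam 0 0 = 1%:M.
Proof.
move=> uW; rewrite /cpow.
have -> : diag_mx (\row_a cexp ((0 +i* 0) * (ln (lam a))%:C)) = 1%:M :> 'M[C]_D.
  rewrite -[RHS]diag_const_mx; congr diag_mx; apply/rowP => a.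
  by rewrite !mxE cexp_lnE !mulr0 expR0 cos0 sin0 mul1r.
by rewrite mulmx1 (unitary_rev uW).
Qed.

(** The eigenvalues of the imaginary power have modulus one and cancel, so the Gram matrix does not
    depend on [t]. *)
Lemma cpow_gram W lam x t : W^H *m W = 1%:M ->
  (cpow W lam x t)^H *m cpow W lam x t =
  W *m diag_mx (\row_a (expR (2 * (ln (lam a) * x)))%:C) *m W^H.
Proof.
move=> uW; rewrite /cpow; set d := \row_a _.
rewrite !adjmxM adjmxK !mulmxA -[W *m _ *m _ *m W]mulmxA uW mulmx1.
rewrite adjmx_diag -[W *m _ *m _]mulmxA mulmx_diag; congr (_ *m diag_mx _ *m _).
by apply/rowP => a; rewrite !mxE mulrC -normCK norm_cexp_ln.
Qed.

Section Product.
Variables (n : nat) (W : 'I_n -> 'M[C]_D) (lam : 'I_n -> 'I_D -> R).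
Hypothesis uW : forall i, (W i)^H *m W i = 1%:M.

Lemma cprod_esum :
  cprod W lam 0 0 = 1%:M /\ is_esum_mx (cprod W lam) (\sum_i clog (W i) (lam i)).
Proof.
rewrite /cprod; elim: (index_enum 'I_n) => [|i r [IH1 IH2]].
  rewrite !big_nil; split=> //.
  by move=> a b; have := is_esum_mx_cst (1%:M : 'M[C]_D) a b; apply: eq_is_esum => x t; rewrite big_nil.
split; first by rewrite big_cons IH1 cpow00 // mulmx1.
rewrite big_cons => a b.
have := is_esum_mxM (@cpow_esum (W i) (lam i)) IH2 a b.
rewrite IH1 cpow00 // mulmx1 mul1mx.
by apply: eq_is_esum => x t; rewrite big_cons.
Qed.

Lemma cprod_unitary t : (cprod W lam 0 t)^H *m cprod W lam 0 t = 1%:M.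
Proof.
rewrite /cprod; elim: (index_enum 'I_n) => [|i r IH].
  by rewrite big_nil adjmx1 mulmx1.
set G := \big[mulmx/1%:M]_(j <- r) _ in IH *.
rewrite big_cons -/G gram_mul cpow_gram //.
have -> : diag_mx (\row_a (expR (2 * (ln (lam i a) * 0)))%:C) = 1%:M :> 'M[C]_D.
  rewrite -[RHS]diag_const_mx; congr diag_mx; apply/rowP => a.
  by rewrite !mxE !mulr0 expR0.
by rewrite mulmx1 (unitary_rev (uW i)) mulmx1.
Qed.

(** A lower bound for the singular values that is uniform in [t]; by [cpow_gram] each factor has
    one. *)
Lemma cprod_lower : exists2 c : R, 0 < c & forall t (v : 'cV[C]_D),
  c%:C * (v^H *m v) 0 0 <=
  ((cprod W lam 1 t *m v)^H *m (cprod W lam 1 t *m v)) 0 0.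
Proof.
rewrite /cprod; elim: (index_enum 'I_n) => [|i r [c c0 IH]].
  by exists 1 => // t v; rewrite big_nil mul1mx mul1r.
(* An explicit positive number below every eigenvalue of the Gram matrix of the factor, also in
   dimension [0], where a minimum would not exist. *)
pose k : R := (1 + \sum_a (expR (2 * (ln (lam i a) * 1)))^-1)^-1.
have s0 (P : pred 'I_D) : 0 <= \sum_(a | P a) (expR (2 * (ln (lam i a) * 1)))^-1.
  by apply: sumr_ge0 => a _; rewrite invr_ge0 expR_ge0.
have k0 : 0 < k by rewrite invr_gt0; have := s0 xpredT; lra.
have kle a : k <= expR (2 * (ln (lam i a) * 1)).
  rewrite -[leRHS]invrK lef_pV2 ?posrE ?invr_gt0 ?expR_gt0 //; last first.
    by have := s0 xpredT; lra.
  by rewrite (bigD1 a) //=; have := s0 (fun j => j != a); lra.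
exists (k * c); first exact: mulr_gt0.
move=> t v; rewrite big_cons.
set G := \big[mulmx/1%:M]_(j <- r) _.
rewrite -mulmxA; set w := G *m v.
have -> : (cpow (W i) (lam i) 1 t *m w)^H *m (cpow (W i) (lam i) 1 t *m w) =
   ((W i)^H *m w)^H *m diag_mx (\row_a (expR (2 * (ln (lam i a) * 1)))%:C) *m ((W i)^H *m w).
  by rewrite gram_mul cpow_gram // adjmxM adjmxK !mulmxA.
set z := (W i)^H *m w.
have zz : (z^H *m z) 0 0 = (w^H *m w) 0 0.
  by rewrite /z adjmxM adjmxK mulmxA -(mulmxA w^H) (unitary_rev (uW i)) mulmx1.
apply: (@le_trans _ _ (k%:C * (w^H *m w) 0 0)).
  by rewrite rmorphM -mulrA ler_wpM2l ?IH // lecR ltW.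
rewrite -zz; clearbody z; rewrite gram_entry -mulmxA mxE mulr_sumr; apply: ler_sum => a _.
rewrite mul_diag_mx adjmxE !mxE [leRHS]mulrCA.
rewrite (_ : Num.conj (z a 0) * z a 0 = `|z a 0| ^+ 2); last by rewrite normCK mulrC.
by rewrite ler_wpM2r ?exprn_ge0 // lecR.
Qed.

End Product.
End MatrixPowers.

(** * The majorization for products of matrix powers *)

Section MatrixTheorem.
Variable R : realType.
Local Notation C := R[i].
Notation mu := (@lebesgue_measure R).
Local Notation "A ^H" := (adjmx A) (at level 8, format "A ^H").

Lemma prod_expR (K : finType) (f : K -> R) :
  \prod_k (expR (f k))%:C = (expR (\sum_k f k))%:C :> C.
Proof. by rewrite expR_sum rmorph_prod. Qed.

Lemma det_cprod_gram D n (W : 'I_n -> 'M[C]_D) (lam : 'I_n -> 'I_D -> R) (x t : R) :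
  (forall i, (W i)^H *m W i = 1%:M) ->
  \det ((cprod W lam x t)^H *m cprod W lam x t) =
  (expR (2 * x * \sum_i \sum_a ln (lam i a)))%:C.
Proof.
move=> uW; rewrite /cprod; elim: (index_enum 'I_n) => [|i r IH].
  by rewrite !big_nil adjmx1 mulmx1 det1 mulr0 expR0.
rewrite !big_cons gram_mul det_mulmx [X in X * _]det_mulmx mulrAC -det_mulmx IH cpow_gram //.
rewrite det_conj_unitary // det_diag.
under eq_bigr do rewrite mxE.
rewrite prod_expR -rmorphM -expRD; congr (expR _)%:C.
rewrite mulrDr addrC; congr (_ + _).
by rewrite mulr_sumr; apply: eq_bigr => a _; ring.
Qed.

Lemma tr_conj_unitary D (W : 'M[C]_D) (d : 'rV[C]_D) : W^H *m W = 1%:M ->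
  \tr (W *m diag_mx d *m W^H) = \sum_a d 0 a.
Proof. by move=> uW; rewrite mxtrace_mulC mulmxA uW mul1mx mxtrace_diag. Qed.

Variables (m n : nat).
Notation D := m.+1.
Variables (W : 'I_n -> 'M[C]_D) (lam : 'I_n -> 'I_D -> R).
Variables (V : 'M[C]_D) (l : 'rV[R]_D) (Z : R -> 'M[C]_D) (y : R -> 'rV[R]_D).
Hypothesis uW : forall i, (W i)^H *m W i = 1%:M.
Hypothesis uV : V^H *m V = 1%:M.
Hypothesis eV : \sum_i clog (W i) (lam i) = V *m diag_mx (\row_a (l 0 a)%:C) *m V^H.
Hypothesis uZ : forall t, (Z t)^H *m Z t = 1%:M.
Hypothesis eZ : forall t, (cprod W lam 1 t)^H *m cprod W lam 1 t =
  Z t *m diag_mx (\row_a (expR (2 * y t 0 a))%:C) *m (Z t)^H.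
Hypothesis y_sorted : forall t (i j : 'I_D), (i <= j)%N -> y t 0 j <= y t 0 i.

(** Both sums are the logarithm of [|det F(1 + it)|]: one by the trace of the sum of logarithms, the
    other by the Gram determinant. *)
Lemma log_sum_eq t : \sum_i y t 0 i = \sum_i l 0 i.
Proof.
have e1 : \sum_i \sum_a ln (lam i a) = \sum_i l 0 i.
  have := congr1 mxtrace eV; rewrite tr_conj_unitary // raddf_sum /=.
  under eq_bigr do rewrite tr_conj_unitary //.
  under eq_bigr do under eq_bigr do rewrite mxE.
  under [RHS]eq_bigr do rewrite mxE.
  under eq_bigr do rewrite -rmorph_sum.
  by rewrite -!rmorph_sum; exact: complexI.
have := det_cprod_gram lam 1 t uW; rewrite eZ det_conj_unitary // det_diag.
under eq_bigr do rewrite mxE.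
rewrite prod_expR e1 mulr1 -mulr_sumr => /complexI/expR_inj.
by apply: mulfI.
Qed.

(** Needed because the regularization adds a constant to [|phi|^2]: its effect on the logarithm is
    small uniformly in [t] only if the singular values stay away from [0]. *)
Lemma log_lower : exists B : R, forall t a, - B <= y t 0 a.
Proof.
have [c c0 hc] := cprod_lower lam uW.
exists (- (ln c / 2)) => t a; rewrite opprK.
have := hc t (col a (Z t)); rewrite gram_mul eZ.
have Za : (Z t)^H *m col a (Z t) = delta_mx a 0.
  by rewrite colE mulmxA uZ mul1mx.
have -> : (col a (Z t))^H *m col a (Z t) = 1%:M.
  apply/matrixP => i j; rewrite !ord1 /=.
  have := congr1 (fun M : 'M[C]_D => M a a) (uZ t); rewrite !mxE !eqxx => <-.
  by apply: eq_bigr => k _; rewrite !mxE.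
have -> : (col a (Z t))^H *m (Z t *m diag_mx (\row_a0 (expR (2 * y t 0 a0))%:C) *m (Z t)^H) *m col a (Z t)
   = ((Z t)^H *m col a (Z t))^H *m diag_mx (\row_a0 (expR (2 * y t 0 a0))%:C) *m ((Z t)^H *m col a (Z t)).
  by rewrite adjmxM adjmxK !mulmxA.
rewrite Za -mulmxA mul_diag_mx.
set X := (X in _ <= X); have -> : X = (expR (2 * y t 0 a))%:C.
  rewrite /X mxE (bigD1 a) //= adjmxE !mxE !eqxx /= rmorph1 mul1r mulr1.
  by rewrite big1 ?addr0 // => k ka; rewrite adjmxE !mxE (negbTE ka) rmorph0 mul0r.
rewrite mxE eqxx mulr1 lecR -ler_ln ?posrE ?expR_gt0 // expRK; lra.
Qed.

Section Minor.
Variables (s : {perm 'I_D}) (k : nat).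
Hypothesis kD : (k < D)%N.

Let f (j : 'I_k) : 'I_D := s (widen_ord (ltnW kD) j).
Let Y : 'M[C]_(D, k) := colsub f V.
Let phi x t := \det (Y^H *m cprod W lam x t *m Y).

Let YAY (A : 'M[C]_D) : Y^H *m A *m Y = mxsub f f (V^H *m A *m V).
Proof.
apply/matrixP => i j; rewrite !mxE; apply: eq_bigr => a _; rewrite !mxE.
by congr (_ * _); apply: eq_bigr => b _; rewrite !mxE.
Qed.

Let f_inj : injective f.
Proof.
move=> i j; rewrite /f => /perm_inj/(congr1 val) /= ij; exact: val_inj.
Qed.

Let uY : Y^H *m Y = 1%:M.
Proof.
rewrite -[Y^H]mulmx1 YAY mulmx1 uV; apply/matrixP => i j.
by rewrite !mxE (inj_eq f_inj).
Qed.

Let phi_esum : is_esum phi (\sum_(i < D | (i < k)%N) l 0 (s i))%:C.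
Proof.
have [F1 hF] := cprod_esum lam uW.
have hG := is_esum_mxM (is_esum_mxM (is_esum_mx_cst Y^H) hF) (is_esum_mx_cst Y).
have eD (P : 'M[C]_D) : (0 *m P + Y^H *m (\sum_i clog (W i) (lam i))) *m Y + Y^H *m P *m 0 =
    diag_mx (\row_j (l 0 (f j))%:C).
  rewrite mul0mx add0r mulmx0 addr0 YAY eV !mulmxA uV mul1mx -mulmxA uV mulmx1.
  by apply/matrixP => i j; rewrite !mxE (inj_eq f_inj).
rewrite eD in hG.
have -> : (\sum_(i < D | (i < k)%N) l 0 (s i))%:C = \sum_i (\row_j (l 0 (f j))%:C) 0 i.
  rewrite rmorph_sum /= big_ord_narrow /=; first exact: ltnW.
  move=> kD'; apply: eq_bigr => i _; rewrite mxE /f; congr (_%:C); congr (l 0 (s _)).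
  exact: val_inj.
by apply: (is_esum_det hG); rewrite F1 mulmx1 uY.
Qed.

Let phi00 : phi 0 0 = 1.
Proof.
have [F1 _] := cprod_esum lam uW.
by rewrite /phi F1 mulmx1 uY det1.
Qed.

Let phi_unit t : `|phi 0 t| ^+ 2 <= 1.
Proof.
have := @norm_det_compress_le _ _ _ Y (cprod W lam 0 t) 1%:M (fun=> 1) uY.
rewrite adjmx1 mulmx1 cprod_unitary // => /(_ erefl (ltnW kD)).
have -> : diag_mx (\row__ 1) = 1%:M :> 'M[C]_D.
  by rewrite -[RHS]diag_const_mx; congr diag_mx; apply/rowP => a; rewrite !mxE.
rewrite !mulmx1 => /(_ erefl (fun=> ltr01) (fun _ _ _ => lexx 1)).
by rewrite big1_eq.
Qed.

Let phi_one t : `|phi 1 t| ^+ 2 <=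
  (expR (2 * \sum_(i < D | (i < k)%N) y t 0 i))%:C.
Proof.
have := @norm_det_compress_le _ _ _ Y (cprod W lam 1 t) (Z t)
  (fun a => (expR (2 * y t 0 a))%:C) uY (uZ t) (ltnW kD) (eZ t).
rewrite mulr_sumr expR_sum rmorph_prod; apply.
- by move=> i; rewrite ltcR expR_gt0.
- by move=> i j ij; rewrite lecR ler_expR ler_pM2l // y_sorted.
Qed.

Lemma partial_sum_approx (e : R) : 0 < e ->
  exists b : R -> R, [/\ continuous b, exists M, forall t, `|b t| <= M,
    forall t, b t <= \sum_(i < D | (i < k)%N) y t 0 i &
    \sum_(i < D | (i < k)%N) l 0 (s i) - e <= \int[mu]_t (b t * beta0 t)].
Proof.
move=> e0; have [B hB] := log_lower.
set sk := \sum_(i < D | _) _.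
have [r [r1 r2]] := phi_esum; rewrite -/sk in r2.
pose S t := \sum_(i < D | (i < k)%N) y t 0 i.
pose B' := \sum_(i < D | (i < k)%N) B.
have SB t : - B' <= S t by rewrite -sumrN; apply: ler_sum => i _.
(* Since [S t >= - B'], adding [h] to [|phi|^2] costs at most a factor [1 + 2 h q] over
   [expR (2 * S t)], that is, at most [h * q] in [logmod]. *)
pose q := expR (2 * B') / 2.
have q0 : 0 < q by rewrite divr_gt0 ?expR_gt0.
(* Makes [|sk| * h + h * q <= e]: the first term is the loss from dividing [sk] by [1 + h], the
   second is the correction subtracted from [logmod]. *)
pose h := e / (`|sk| + q + 1).
have d0 : 0 < `|sk| + q + 1 by rewrite ltr_wpDl // addr_ge0 // ltW.
have h0 : 0 < h by rewrite divr_gt0.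
have sq x t : `|phi x t| ^+ 2 = (esum_re r x t ^+ 2 + esum_im r x t ^+ 2)%:C.
  by rewrite r1 esumE sqr_normC_ReIm.
have unit t : esum_re r 0 t ^+ 2 + esum_im r 0 t ^+ 2 <= 1.
  by rewrite -lecR -sq phi_unit.
have [re00 im00] : esum_re r 0 0 = 1 /\ esum_im r 0 0 = 0.
  by have := phi00; rewrite r1 esumE => -[-> ->].
have core := esum_core h0 unit re00 im00.
have dre : esum_re (esum_der r) 0 0 = sk.
  by move: r2; rewrite esumE => -[->].
rewrite dre in core.
have [M hM] := logmod_bounded r h0.
have cl : continuous (logmod r h 1) by exact: continuous_logmod.
have il : -1 <= (1 : R) <= 2 by lra.
have bl t : `|logmod r h 1 t| <= M by case: (hM 1 t il).
exists (fun t => logmod r h 1 t - h * q); split.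
- by move=> t; apply: cvgB; [exact: cl|exact: cvg_cst].
- exists (M + `|h * q|) => t; rewrite (le_trans (ler_normB _ _)) // lerD2r.
  exact: bl.
- move=> t; rewrite lerBlDr -/(S t) /logmod.
  have G0 : 0 < esum_re r 1 t * esum_re r 1 t + esum_im r 1 t * esum_im r 1 t + h.
    by rewrite ltr_wpDl // addr_ge0 // -expr2 sqr_ge0.
  have G1 : esum_re r 1 t * esum_re r 1 t + esum_im r 1 t * esum_im r 1 t <= expR (2 * S t).
    by rewrite -!expr2 -lecR -sq phi_one.
  have E0 := expR_gt0 (2 * S t).
  have G2 : esum_re r 1 t * esum_re r 1 t + esum_im r 1 t * esum_im r 1 t + h <=
      expR (2 * S t) * (1 + h * (2 * q)).
    rewrite mulrDr mulr1 lerD // mulrCA -[leLHS]mulr1 ler_wpM2l ?(ltW h0) //.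
    have -> : 2 * q = expR (2 * B') by rewrite /q; field.
    rewrite -expRD -[leLHS]expR0 ler_expR.
    by have := SB t; lra.
  have hq0 : 0 <= h * (2 * q).
    by apply: mulr_ge0; [exact: ltW|apply: mulr_ge0 => //; exact: ltW].
  have hq : 0 < 1 + h * (2 * q) by lra.
  have : ln (esum_re r 1 t * esum_re r 1 t + esum_im r 1 t * esum_im r 1 t + h) <=
     2 * S t + h * (2 * q).
    apply: (@le_trans _ _ (ln (expR (2 * S t) * (1 + h * (2 * q))))).
      by rewrite ler_ln ?posrE // mulr_gt0.
    rewrite lnM ?posrE // expRK lerD2l.
    by apply: le_ln1Dx; lra.
  have : 0 <= ln (1 + h) by rewrite ln_ge0 // lerDl ltW.
  by rewrite -[_ / 2]/(_ * 2^-1) ler_pdivrMr //; lra.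
- have il1 := integrable_beta0M cl bl.
  have ch : continuous (fun _ : R => h * q : R) by move=> ?; exact: cvg_cst.
  have ihq := integrable_beta0M ch (fun=> lexx _).
  under eq_Rintegral do rewrite mulrBl.
  rewrite (RintegralB measurableT il1 ihq) Rintegral_beta0M.
  have s1 : sk - `|sk| * h <= sk / (1 + h).
    rewrite ler_pdivlMr; last by rewrite addr_gt0.
    have := ler_norm sk; have := normr_ge0 sk; nra.
  have s2 : `|sk| * h + h * q <= e.
    rewrite (mulrC _ h) -mulrDr /h mulrAC ler_pdivrMr // ler_pM2l //; lra.
  lra.
Qed.

End Minor.

Theorem matrix_majorization (H : 'rV[R]_D -> R) : convex_rV H ->
  (forall (s : {perm 'I_D}) (x : 'rV[R]_D), H (\row_i x 0 (s i)) = H x) ->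
  ((H l)%:E <= \int[mu]_(t in setT) (H (y t) * beta0 t)%:E)%E.
Proof.
move=> cH pH; apply: majorization_integral => //.
- exact: log_sum_eq.
- by move=> s k e kD e0; exact: partial_sum_approx.
Qed.

End MatrixTheorem.

(** * Tensors as matrices *)

Section Spectral.
Variables (R : realType) (D : nat).
Local Notation C := R[i].
Local Notation "A ^H" := (adjmx A) (at level 8, format "A ^H").
Implicit Types (A W : 'M[C]_D) (lam : 'I_D -> R).

Definition mspec A W lam :=
  W^H *m W = 1%:M /\ A = W *m diag_mx (\row_a (lam a)%:C) *m W^H.

Lemma spectral_entry W (d : 'rV[C]_D) i j :
  (W *m diag_mx d *m W^H) i j = \sum_a d 0 a * (W i a * Num.conj (W j a)).
Proof.
by rewrite mul_mx_diag mxE; apply: eq_bigr => a _; rewrite !mxE; ring.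
Qed.

Lemma eq_conj_diag W (d d' : 'rV[C]_D) : d = d' ->
  W *m diag_mx d *m W^H = W *m diag_mx d' *m W^H.
Proof. by move=> ->. Qed.

(* [V = W'^H W] intertwines the two diagonal matrices, hence also their images
   under [g]. *)
Lemma mspec_fun A W W' lam lam' (g : R -> C) : mspec A W lam -> mspec A W' lam' ->
  W *m diag_mx (\row_a g (lam a)) *m W^H = W' *m diag_mx (\row_a g (lam' a)) *m W'^H.
Proof.
move=> [uW eW] [uW' eW'].
pose V := W'^H *m W.
have WV : W' *m V = W by rewrite mulmxA (unitary_rev uW') mul1mx.
have VW : V *m W^H = W'^H by rewrite -mulmxA (unitary_rev uW) mulmx1.
have eV : V *m diag_mx (\row_a (lam a)%:C) = diag_mx (\row_a (lam' a)%:C) *m V.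
  have : W'^H *m A *m W = W'^H *m A *m W by [].
  rewrite {1}eW eW' !mulmxA uW' mul1mx -!mulmxA uW mulmx1.
  by rewrite /V !mulmxA.
clearbody V.
have gV : V *m diag_mx (\row_a g (lam a)) = diag_mx (\row_a g (lam' a)) *m V.
  apply/matrixP => a b; have := congr1 (fun M : 'M[C]_D => M a b) eV.
  rewrite !mul_mx_diag !mul_diag_mx !mxE.
  have [->|V0] := eqVneq (V a b) 0; first by rewrite !mul0r !mulr0.
  by rewrite [RHS]mulrC => /(mulfI V0)/complexI ->; rewrite mulrC.
by rewrite -{1}WV -(mulmxA W') gV -!mulmxA VW.
Qed.

Lemma mspec_perm A W lam (s : {perm 'I_D}) :
  mspec A W lam -> mspec A (col_perm s W) (lam \o s).
Proof.
move=> [uW eW]; split.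
  apply/matrixP => i j; have := congr1 (fun M : 'M[C]_D => M (s i) (s j)) uW.
  rewrite !mxE (inj_eq perm_inj) => <-.
  by apply: eq_bigr => a _; rewrite !mxE.
apply/matrixP => i j; rewrite eW !spectral_entry (reindex_inj (@perm_inj _ s)).
by apply: eq_bigr => a _; rewrite !mxE.
Qed.

(** Applying [mspec_fun] to the indicator of a real number and taking traces equates the
    multiplicities of that number. *)
Lemma mspec_uniq A W W' lam lam' : mspec A W lam -> mspec A W' lam' ->
  exists s : {perm 'I_D}, forall a, lam' a = lam (s a).
Proof.
move=> sW sW'.
have cnt (r : R) : \sum_a ((lam a == r)%:R : C) = \sum_a (lam' a == r)%:R.
  have := congr1 mxtrace (mspec_fun (fun z => (z == r)%:R) sW sW').
  rewrite (tr_conj_unitary _ sW.1) (tr_conj_unitary _ sW'.1).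
  by under eq_bigr do rewrite mxE; under [RHS]eq_bigr do rewrite mxE.
pose tl := [tuple lam a | a < D]; pose tl' := [tuple lam' a | a < D].
have ctE (f : 'I_D -> R) r : (count_mem r [tuple f a | a < D] : nat)%:R =
    \sum_a ((f a == r)%:R : C).
  rewrite -natr_sum; congr _%:R.
  by rewrite count_map /= -sumn_count sumnE big_map big_enum.
have : perm_eq tl' tl.
  apply/allP => r _ /=; rewrite -(eqr_nat C) !ctE; exact/eqP/esym/cnt.
move=> /tuple_permP[s es]; exists s => a.
have /val_inj := es; move=> /(congr1 (fun t => tnth t a)).
by rewrite !tnth_mktuple.
Qed.

End Spectral.

Section TensorMatrix.
Variables (R : realType) (N : nat) (I : 'I_N -> nat).
Local Notation C := R[i].
Local Notation D := (dimT I).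
Local Notation T := (tensor R I).
Local Notation "A ^H" := (adjmx A) (at level 8, format "A ^H").
Implicit Types (A B : T) (W : 'M[C]_D) (lam : 'I_D -> R).

Definition idx (a : 'I_D) : midx I := enum_val a.
Definition rk (i : midx I) : 'I_D := enum_rank i.

Lemma idxK : cancel idx rk. Proof. exact: enum_valK. Qed.
Lemma rkK : cancel rk idx. Proof. exact: enum_rankK. Qed.

Definition toM A : 'M[C]_D := \matrix_(a, b) A (idx a) (idx b).

Lemma toM_inj : injective toM.
Proof.
move=> A B e; apply/ffunP => i; apply/ffunP => j.
by have := congr1 (fun M : 'M[C]_D => M (rk i) (rk j)) e; rewrite !mxE !rkK.
Qed.

Lemma toM_mul A B : toM (tmul A B) = toM A *m toM B.
Proof.
apply/matrixP => a b; rewrite !mxE !ffunE (reindex idx) /=; last first.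
  by exists rk => x _; [exact: idxK|exact: rkK].
by apply: eq_bigr => c _; rewrite !mxE.
Qed.

Lemma toM_id : toM (tid R I) = 1%:M.
Proof.
apply/matrixP => a b; rewrite !mxE !ffunE.
have [->|ab] := eqVneq a b; first by rewrite big1 // => k _; rewrite eqxx.
have /existsP[k kab] : [exists k, idx a k != idx b k].
  rewrite -negb_forall; apply: contra ab => /forallP h.
  by apply/eqP/(can_inj idxK)/ffunP => k; apply/eqP/h.
by rewrite (bigD1 k) //= (negbTE kab) mul0r.
Qed.

Lemma toM_H A : toM (tH A) = (toM A)^H.
Proof. by apply/matrixP => a b; rewrite !mxE !ffunE. Qed.

Lemma toM_sum (K : Type) (r : seq K) (F : K -> T) :
  toM (\sum_(k <- r) F k) = \sum_(k <- r) toM (F k).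
Proof.
elim: r => [|k r IH].
  by rewrite !big_nil; apply/matrixP => a b; rewrite !mxE !ffunE.
by rewrite !big_cons -IH; apply/matrixP => a b; rewrite !mxE !ffunE.
Qed.

Lemma toM_prod n (F : 'I_n -> T) :
  toM (tprod F) = \big[mulmx/1%:M]_(i < n) toM (F i).
Proof. by apply: big_morph; [exact: toM_mul|exact: toM_id]. Qed.

Definition colsM (U : 'I_D -> tvec R I) : 'M[C]_D := \matrix_(a, b) U b (idx a).

Lemma toM_spectral (U : 'I_D -> tvec R I) (g : 'I_D -> C) :
  toM (\sum_(a < D) g a *: touter (U a)) =
  colsM U *m diag_mx (\row_a g a) *m (colsM U)^H.
Proof.
rewrite toM_sum; apply/matrixP => i j; rewrite spectral_entry summxE.
by apply: eq_bigr => a _; rewrite !mxE !ffunE.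
Qed.

Lemma spec_decP A lam U : spec_dec A lam U <-> mspec (toM A) (colsM U) lam.
Proof.
have innerE a b : ((colsM U)^H *m colsM U) a b = tinner (U a) (U b).
  rewrite mxE /tinner (reindex idx) /=; last first.
    by exists rk => x _; [exact: idxK|exact: rkK].
  by apply: eq_bigr => c _; rewrite !mxE.
split=> [[oU eA]|[uU eA]]; split.
- by apply/matrixP => a b; rewrite innerE oU mxE.
- by rewrite {1}eA toM_spectral.
- by move=> a b; rewrite -innerE uU mxE.
- by apply: toM_inj; rewrite toM_spectral.
Qed.

Definition ofcols W : 'I_D -> tvec R I := fun b => [ffun i => W (rk i) b].

Lemma ofcolsK W : colsM (ofcols W) = W.
Proof. by apply/matrixP => a b; rewrite !mxE ffunE idxK. Qed.

Lemma mspec_dec A W lam : mspec (toM A) W lam -> spec_dec A lam (ofcols W).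
Proof. by move=> h; apply/spec_decP; rewrite ofcolsK. Qed.

(** The decomposition selected by [xget] is unknown, but [mspec_fun] shows that every decomposition
    gives the same matrix. *)
Lemma toM_tfun (g : R -> C) A W lam : mspec (toM A) W lam ->
  toM (tfun g A) = W *m diag_mx (\row_a g (lam a)) *m W^H.
Proof.
move=> sA; rewrite /tfun.
set P := (fun X => exists lam, _).
have [|lam' [U [sU ->]]] := @xgetPex _ (0 : T) P.
  by exists (\sum_(a < D) g (lam a) *: touter (ofcols W a)), lam, (ofcols W); split=> //; exact: mspec_dec.
rewrite toM_spectral; apply: mspec_fun sA; exact/spec_decP.
Qed.

Lemma mspec_tfun (g : R -> R) A W lam : mspec (toM A) W lam ->
  mspec (toM (tfun (fun x => (g x)%:C) A)) W (g \o lam).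
Proof. by move=> sA; split; [exact: sA.1|rewrite (toM_tfun _ sA)]. Qed.

Lemma mspec_gram A W lam : mspec (toM A) W lam ->
  mspec (toM (tmul (tH A) A)) W (fun a => lam a ^+ 2).
Proof.
move=> [uW eA]; split=> //; rewrite toM_mul toM_H eA; set d := diag_mx _.
have -> : (W *m d *m W^H)^H *m (W *m d *m W^H) = W *m (d^H *m d) *m W^H.
  by rewrite gram_mul adjmxK gram_mul uW mulmx1.
rewrite adjmx_diag mulmx_diag; apply: eq_conj_diag; apply/rowP => a.
by rewrite !mxE rmorphXn expr2; congr (_ * _); exact: conjc_real.
Qed.

Lemma mspec_tabs A W lam : mspec (toM A) W lam ->
  mspec (toM (tabs A)) W (fun a => `|lam a|).
Proof.
move=> /mspec_gram/(mspec_tfun Num.sqrt) [uW e]; split=> //.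
rewrite [LHS]e; apply: eq_conj_diag; apply/rowP => a.
by rewrite !mxE /= sqrtr_sqr.
Qed.

Lemma eigvecE A W lam : mspec (toM A) W lam ->
  exists s : {perm 'I_D}, eigvec A = \row_i lam (s i).
Proof.
move=> sA; rewrite /eigvec; set P := (fun v => _ /\ _).
have [|_ [U sU]] := @xgetPex _ (0 : 'rV[R]_D) P.
  have [s hs] := sorting_perm lam.
  exists (\row_i lam (s i)); split; first by move=> a b ab; rewrite !mxE hs.
  exists (ofcols (col_perm s W)).
  have [h1 h2] := mspec_perm s sA.
  apply: mspec_dec; split=> //; rewrite h2; apply: eq_conj_diag.
  by apply/rowP => a; rewrite !mxE.
have [s hs] := mspec_uniq sA ((spec_decP _ _ _).1 sU).
by exists s; apply/rowP => i; rewrite [RHS]mxE -hs.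
Qed.

(** A gauge ignores signs and order, so any spectral decomposition of [A] itself computes the
    norm. *)
Lemma tnormE (rho : 'rV[R]_D -> R) A W lam : sym_gauge rho ->
  mspec (toM A) W lam -> tnorm rho A = rho (\row_i lam i).
Proof.
move=> [_ _ _ rho_perm rho_abs] sA; rewrite /tnorm.
have [s ->] := eigvecE (mspec_tabs sA).
rewrite -[RHS]rho_abs -[RHS](rho_perm s); congr rho.
by apply/rowP => i; rewrite !mxE.
Qed.

Lemma posdef_mspec A : posdef A ->
  exists W lam, mspec (toM A) W lam /\ forall a, 0 < lam a.
Proof. by move=> [lam [U [/spec_decP sA l0]]]; exists (colsM U), lam. Qed.

Lemma hermitian_mspec A : (toM A)^H = toM A -> exists W lam, mspec (toM A) W lam.
Proof.
move=> /hermitian_spectral[W uW [d dR eA]].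
exists W, (fun a => complex.Re (d 0 a)); split; first exact: uW.
apply: (etrans eA); apply: eq_conj_diag; apply/rowP => a.
by rewrite mxE RRe_real.
Qed.

End TensorMatrix.

(** * Transfer to tensors and the two inequalities *)

Section Final.
Variable R : realType.
Local Notation C := R[i].
Notation mu := (@lebesgue_measure R).
Local Notation "A ^H" := (adjmx A) (at level 8, format "A ^H").

(** Restates [matrix_majorization] for a positive dimension, since [dimT I] is not syntactically a
    successor. *)
Lemma matrix_majorization_pos (D n : nat) (W : 'I_n -> 'M[C]_D)
    (lam : 'I_n -> 'I_D -> R) (V : 'M[C]_D) (l : 'rV[R]_D)
    (Z : R -> 'M[C]_D) (y : R -> 'rV[R]_D) (H : 'rV[R]_D -> R) : (0 < D)%N ->
  (forall i, (W i)^H *m W i = 1%:M) -> V^H *m V = 1%:M ->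
  \sum_i clog (W i) (lam i) = V *m diag_mx (\row_a (l 0 a)%:C) *m V^H ->
  (forall t, (Z t)^H *m Z t = 1%:M) ->
  (forall t, (cprod W lam 1 t)^H *m cprod W lam 1 t =
    Z t *m diag_mx (\row_a (expR (2 * y t 0 a))%:C) *m (Z t)^H) ->
  (forall t (i j : 'I_D), (i <= j)%N -> y t 0 j <= y t 0 i) ->
  convex_rV H ->
  (forall (s : {perm 'I_D}) (x : 'rV[R]_D), H (\row_i x 0 (s i)) = H x) ->
  ((H l)%:E <= \int[mu]_(t in setT) (H (y t) * beta0 t)%:E)%E.
Proof.
case: D W lam V l Z y H => // m W lam V l Z y H _ uW uV eV uZ eZ ys cH pH.
exact: (@matrix_majorization R m n W lam V l Z y uW uV eV uZ eZ ys H cH pH).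
Qed.

Lemma clog_hermitian D (W : 'M[C]_D) (lam : 'I_D -> R) :
  (clog W lam)^H = clog W lam.
Proof.
rewrite /clog !adjmxM adjmxK mulmxA adjmx_diag; apply: eq_conj_diag.
by apply/rowP => a; rewrite !mxE; exact: conjc_real.
Qed.

(* The eigenvalues of [A^H A] are positive because its determinant does not vanish. *)
Lemma gram_log_spectral (D : nat) (A : 'M[C]_D) (r : R) :
  \det (A^H *m A) = (expR r)%:C ->
  exists (Z : 'M[C]_D) (y : 'rV[R]_D),
    mspec (A^H *m A) Z (fun a => expR (2 * y 0 a)) /\
    (forall i j : 'I_D, (i <= j)%N -> y 0 j <= y 0 i).
Proof.
have [Z uZ [d d0 eZ]] := gram_spectral A.
rewrite eZ det_conj_unitary // det_diag => ed.
have dpos a : 0 < d 0 a.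
  rewrite lt0r d0 andbT; apply/eqP => da.
  have := ed; rewrite (bigD1 a) //= da mul0r => e0.
  have : 0 < (expR r)%:C :> C by rewrite ltcR expR_gt0.
  by rewrite -e0 ltxx.
pose p a := complex.Re (d 0 a).
have pE a : d 0 a = (p a)%:C by rewrite /p RRe_real // ger0_real.
have p0 a : 0 < p a by rewrite -ltcR -pE.
have [s hs] := sorting_perm p.
have dp : d = \row_a (p a)%:C by apply/rowP => a; rewrite mxE -pE.
rewrite -eZ; have sp : mspec (A^H *m A) Z p.
  exact: (conj uZ (etrans eZ (eq_conj_diag Z dp))).
(* Eigenvalues of the Gram matrix are squared singular values; halving gives the logarithms of the
   singular values. *)
pose y : 'rV[R]_D := \row_a (ln (p (s a)) / 2).
exists (col_perm s Z), y; split.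
  have -> : (fun a => expR (2 * y 0 a)) = p \o s.
    by apply/funext => a; rewrite mxE mulrC divfK // lnK ?posrE.
  exact: (mspec_perm s sp).
by move=> i j ij; rewrite !mxE ler_pM2r ?invr_gt0 // ler_ln ?posrE // hs.
Qed.

End Final.

Theorem theorem1p1 (R : realType) (N : nat) (I : 'I_N -> nat) (n : nat)
    (Cs : 'I_n -> tensor R I) (rho : 'rV[R]_(dimT I) -> R) :
  (forall k, (0 < I k)%N) -> (0 < n)%N ->
  (forall i, posdef (Cs i)) -> sym_gauge rho ->
  let LHS (f : R -> R) :=
    tnorm rho (tfun (fun x => (f x)%:C) (texp (\sum_(i < n) tlog (Cs i)))) in
  let RHS (f : R -> R) (t : R) :=
    tnorm rho (tfun (fun x => (f x)%:C)
      (tabs (tprod (fun i => tpow (Cs i) (1 + 'i * t%:C))))) in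
  (forall f : R -> R,
     {within [set x | 0 < x], continuous f} ->
     (forall x, 0 < x -> 0 < f x) ->
     (forall (x y a : R), 0 <= a <= 1 ->
        ln (f (expR ((1 - a) * x + a * y)))
          <= (1 - a) * ln (f (expR x)) + a * ln (f (expR y))) ->
     ((LHS f)%:E <=
        expeR (\int[lebesgue_measure]_(t in setT)
                  (ln (RHS f t) * beta0 t)%:E))%E) /\
  (forall g : R -> R,
     {within [set x | 0 < x], continuous g} ->
     (forall x, 0 < x -> 0 <= g x) ->
     (forall (x y a : R), 0 <= a <= 1 ->
        g (expR ((1 - a) * x + a * y))
          <= (1 - a) * g (expR x) + a * g (expR y)) ->
     ((LHS g)%:E <=
        \int[lebesgue_measure]_(t in setT) (RHS g t * beta0 t)%:E)%E).

Proof.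
move=> I0 n0 Cpos rhoG LHS RHS.
(* In dimension [0] every gauge is identically [0], and the logarithm in the first part would lose
   its meaning. *)
have D0 : (0 < dimT I)%N.
  by apply/card_gt0P; exists [ffun k => Ordinal (I0 k)].
have /choice[W /choice[lam hC]] := fun i => posdef_mspec (Cpos i).
have uW i : adjmx (W i) *m W i = 1%:M := (hC i).1.1.
have logE : toM (\sum_(i < n) tlog (Cs i)) = \sum_i clog (W i) (lam i).
  rewrite toM_sum; apply: eq_bigr => i _.
  exact: (toM_tfun (fun x => (ln x)%:C) (hC i).1).
have logH : adjmx (toM (\sum_(i < n) tlog (Cs i))) = toM (\sum_(i < n) tlog (Cs i)).
  rewrite logE; apply/matrixP => a b; rewrite adjmxE !summxE rmorph_sum.
  apply: eq_bigr => i _; apply: (etrans (esym (adjmxE (clog (W i) (lam i)) a b))).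
  by rewrite clog_hermitian.
have [V [l sL]] := hermitian_mspec logH.
have prodE t : toM (tprod (fun i => tpow (Cs i) (1 + 'i * t%:C))) = cprod W lam 1 t.
  have -> : 1 + 'i * t%:C = 1 +i* t.
    by apply/eqP; rewrite eq_complex /=; apply/andP; split; apply/eqP; ring.
  rewrite toM_prod; apply: eq_bigr => i _; exact: (toM_tfun _ (hC i).1).
have /choice[Z /choice[y hy]] := fun t => gram_log_spectral (det_cprod_gram lam 1 t uW).
pose lr : 'rV[R]_(dimT I) := \row_a l a.
have LHSE f : LHS f = gauge_exp rho f lr.
  rewrite /LHS (tnormE rhoG (mspec_tfun f (mspec_tfun expR sL))).
  by congr rho; apply/rowP => a; rewrite !mxE.
have RHSE f t : RHS f t = gauge_exp rho f (y t).
  rewrite /RHS.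
  set M := tprod _.
  have sM : mspec (toM (tmul (tH M) M)) (Z t) (fun a => expR (2 * y t 0 a)).
    by rewrite toM_mul toM_H prodE; exact: (hy t).1.
  rewrite (tnormE rhoG (mspec_tfun f (mspec_tfun Num.sqrt sM))).
  congr rho; apply/rowP => a; rewrite !mxE /=; congr f.
  by rewrite expRM_natl sqrtr_sqr ger0_norm ?expR_ge0.
have main (H : 'rV[R]_(dimT I) -> R) : convex_rV H ->
    (forall (s : {perm 'I_(dimT I)}) (x : 'rV[R]_(dimT I)), H (\row_i x 0 (s i)) = H x) ->
    ((H lr)%:E <= \int[lebesgue_measure]_(t in setT) (H (y t) * beta0 t)%:E)%E.
  move=> cH pH; apply: (matrix_majorization_pos D0 uW sL.1 _ (fun t => (hy t).1.1)
    (fun t => (hy t).1.2) (fun t => (hy t).2) cH pH).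
  rewrite -logE sL.2; apply: eq_conj_diag.
  by apply/rowP => a; rewrite !mxE.
split=> [f _ f0 cf|g _ g0 cg].
- rewrite LHSE.
  have -> : (gauge_exp rho f lr)%:E = expeR (ln (gauge_exp rho f lr))%:E.
    by rewrite /= lnK // posrE gauge_exp_gt0.
  rewrite lee_expeR.
  under eq_integral do rewrite RHSE.
  apply: (main (fun x => ln (gauge_exp rho f x))).
    exact: ln_gauge_exp_convex.
  by move=> s x; rewrite gauge_exp_perm.
- rewrite LHSE; under eq_integral do rewrite RHSE.
  apply: main; first exact: gauge_exp_convex.
  by move=> s x; rewrite gauge_exp_perm.
Qed.
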